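(* Let $\mathscr{M}=\{m_n\}_{n\in\mathbb{N}_0}$ be a weight sequence, $N\in\mathbb{N}$, and let $a_1,\dots,a_N$ be real-valued elements of $\mathcal{E}_{\mathscr{M}}(\mathbb{T})$. On $\mathbb{T}^{N+1}$, with coordinates $(t,x)$, $t\in\mathbb{T}^N$, $x\in\mathbb{T}$, consider the system of vector fields $$L_j=\frac{\partial}{\partial t_j}+a_j(t_j)\frac{\partial}{\partial x},\qquad j=1,\dots,N,$$ and the system $$\tilde L_j=\frac{\partial}{\partial t_j}+a_{j_0}\frac{\partial}{\partial x},\qquad a_{j_0}=\frac{1}{2\pi}\int_0^{2\pi}a_j(s)\,ds,\qquad j=1,\dots,N.$$ Then the system $(L_j)_{j=1}^N$ is globally $\mathscr{M}$-hypoelliptic if and only if the system $(\tilde L_j)_{j=1}^N$ is globally $\mathscr{M}$-hypoelliptic.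
   Context: $\mathbb{N}=\{1,2,\dots\}$, $\mathbb{N}_0=\mathbb{N}\cup\{0\}$, $\mathbb{T}^d=\mathbb{R}^d/2\pi\mathbb{Z}^d$. A weight sequence is a sequence $\mathscr{M}=\{m_n\}_{n\in\mathbb{N}_0}$ of positive reals with: $m_0=m_1=1$; $m_n^2\le m_{n-1}m_{n+1}$ for all $n\in\mathbb{N}$; and there is $H>1$ with $m_{j+k}\le H^{j+k}m_jm_k$ for all $j,k\in\mathbb{N}_0$. For each dimension $d$, $\mathcal{E}_{\mathscr{M}}(\mathbb{T}^d)$ is the space of $f\in C^\infty(\mathbb{T}^d)$ (complex-valued) for which there are $C,h>0$ with $|D^\alpha f(x)|\le C h^{|\alpha|}m_{|\alpha|}|\alpha|!$ for all $x\in\mathbb{T}^d$, $\alpha\in\mathbb{N}_0^d$, where $D=-i\partial$. For $h>0$, $\mathcal{E}_{\mathscr{M},h}(\mathbb{T}^d)$ is the Banach space of those $f$ with $\|f\|_{\mathscr{M},h}:=\sup_{x,\alpha}\frac{|D^\alpha f(x)|}{h^{|\alpha|}m_{|\alpha|}|\alpha|!}<\infty$. $\mathcal{E}_{\mathscr{M}}(\mathbb{T}^d)$ carries the locally convex inductive limit topology of the spaces $\mathcal{E}_{\mathscr{M},h_n}(\mathbb{T}^d)$ for any strictly increasing positive sequence $h_n\to+\infty$ (the topology does not depend on the choice). $\mathscr{D}'_{\mathscr{M}}(\mathbb{T}^d)$ is the topological dual of $\mathcal{E}_{\mathscr{M}}(\mathbb{T}^d)$; $\mathcal{E}_{\mathscr{M}}(\mathbb{T}^d)$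 is regarded as a subspace of it via $\langle f,\varphi\rangle=\int_{\mathbb{T}^d}f\varphi\,dx$. Derivatives and multiplication by elements of $\mathcal{E}_{\mathscr{M}}$ act on $\mathscr{D}'_{\mathscr{M}}$ by duality. A system $(Q_j)_{j=1}^N$ of such operators on $\mathbb{T}^{N+1}$ is globally $\mathscr{M}$-hypoelliptic if: whenever $u\in\mathscr{D}'_{\mathscr{M}}(\mathbb{T}^{N+1})$ and $Q_ju\in\mathcal{E}_{\mathscr{M}}(\mathbb{T}^{N+1})$ for all $j=1,\dots,N$, then $u\in\mathcal{E}_{\mathscr{M}}(\mathbb{T}^{N+1})$. *)

(* Defs.v *)
From HB Require Import structures.
From mathcomp Require Import all_boot all_order all_algebra.
From mathcomp Require Import all_classical all_reals all_analysis.
From mathcomp Require Export complex.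
Set Implicit Arguments.
Unset Strict Implicit.
Unset Printing Implicit Defensive.
Import Order.TTheory GRing.Theory Num.Theory.
Import numFieldNormedType.Exports.
Local Open Scope classical_set_scope.
Local Open Scope ring_scope.
Import Normc.
Local Open Scope complex_scope.

Record weight_sequence (R : realType) (m : nat -> R) : Prop := WeightSequence {
  weight_gt0 : forall n, 0 < m n ;
  weight_0 : m 0%N = 1 ;
  weight_1 : m 1%N = 1 ;
  weight_logconvex : forall n, (0 < n)%N -> m n ^+ 2 <= m n.-1 * m n.+1 ;
  weight_moderate : exists2 H : R, 1 < H &
    forall j k, m (j + k)%N <= H ^+ (j + k) * m j * m k }.

Section Torus.
Variables (R : realType) (d : nat).
Implicit Types (i : 'I_d) (x : 'rV[R]_d) (f : 'rV[R]_d -> R[i])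
  (alpha : {ffun 'I_d -> nat}).

(* Functions on the torus (R / 2 pi Z)^d are the functions on R^d which are
   2 pi-periodic in each coordinate. *)
Definition periodic f :=
  forall i x, f (x + (2 * pi) *: delta_mx ord0 i) = f x.

(* R[i] is not a normed module over R in the library: continuity,
   differentiation and integration of complex-valued functions of real
   variables are taken on real and imaginary parts. *)
Definition cpartial i f : 'rV[R]_d -> R[i] := fun x =>
  'D_(delta_mx ord0 i) (fun y => complex.Re (f y)) x +i*
  'D_(delta_mx ord0 i) (fun y => complex.Im (f y)) x.

Definition cpartial_seq (s : seq 'I_d) f := foldr cpartial f s.

Definition ccontinuous f :=
  continuous (fun y => complex.Re (f y)) /\
  continuous (fun y => complex.Im (f y)).

Definition cpartial_derivable i f x :=
  derivable (fun y => complex.Re (f y)) x (delta_mx ord0 i) /\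
  derivable (fun y => complex.Im (f y)) x (delta_mx ord0 i).

Definition smooth f := forall s : seq 'I_d,
  ccontinuous (cpartial_seq s f) /\
  forall i x, cpartial_derivable i (cpartial_seq s f) x.

Definition mlength alpha : nat := (\sum_i alpha i)%N.

(* D^alpha with D = - i \partial *)
Definition Dmulti alpha f : 'rV[R]_d -> R[i] := fun x =>
  (0 -i* 1) ^+ mlength alpha *
  foldr (fun i => iter (alpha i) (cpartial i)) f (enum 'I_d) x.

Definition set_coord i (s : R) x : 'rV[R]_d :=
  \row_j (if j == i then s else x ord0 j).

Definition integral_coord i (g : 'rV[R]_d -> R) : 'rV[R]_d -> R := fun x =>
  \int[lebesgue_measure]_(s in `[0, 2 * pi]) g (set_coord i s x).

(* Iterated integral over [0, 2 pi]^d.  All coordinates are integrated out, so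
   the base point 0 is irrelevant. *)
Definition torus_integral_real (g : 'rV[R]_d -> R) : R :=
  foldr integral_coord g (enum 'I_d) 0.

Definition torus_integral f : R[i] :=
  torus_integral_real (fun x => complex.Re (f x)) +i*
  torus_integral_real (fun x => complex.Im (f x)).

End Torus.

Section Ultradifferentiable.
Variables (R : realType) (m : nat -> R) (d : nat).
Local Notation fct := ('rV[R]_d -> R[i]).
Implicit Types (f g : fct) (u : fct -> R[i]).

Definition ud_weight (h : R) (n : nat) : R := h ^+ n * m n * (n`!)%:R.

Definition ud : set fct := [set f | [/\ periodic f, smooth f &
  exists C h : R, [/\ 0 < C, 0 < h & forall x (alpha : {ffun 'I_d -> nat}),
    normc (Dmulti alpha f x) <= C * ud_weight h (mlength alpha)]]].

Definition ud_norm (h : R) f : \bar R :=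
  ereal_sup [set (normc (Dmulti alpha f x) / ud_weight h (mlength alpha))%:E
            | x in [set: 'rV[R]_d] & alpha in [set: {ffun 'I_d -> nat}]].

Definition ud_step (h : R) : set fct :=
  [set f | [/\ periodic f, smooth f & (ud_norm h f < +oo)%E]].

Definition absolutely_convex (V : set fct) := forall (a b : R[i]) f g,
  V f -> V g -> normc a + normc b <= 1 -> V (fun x => a * f x + b * g x).

(* Basic neighbourhoods of 0 for the locally convex inductive limit topology
   of the steps h_n = n + 1: the absolutely convex sets whose trace on every
   step is a neighbourhood of 0. *)
Definition ud_basic_nbhs0 (V : set fct) := [/\ V `<=` ud, absolutely_convex V &
  forall n : nat, exists2 r : R, 0 < r &
    forall f, ud_step n.+1%:R f -> (ud_norm n.+1%:R f < r%:E)%E -> V f].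

Definition ud_nbhs f : set (set fct) := [set U | exists2 V, ud_basic_nbhs0 V &
  forall g, V g -> U (fun x => f x + g x)].

Definition linear_on_ud u := forall (a : R[i]) f g, ud f -> ud g ->
  u (fun x => a * f x + g x) = a * u f + u g.

Definition continuous_on_ud u := forall f, ud f -> forall eps : R, 0 < eps ->
  ud_nbhs f [set g | normc (u g - u f) < eps].

(* An element of the dual is represented by a function on all of [fct] of
   which only the restriction to [ud] is meaningful: statements below only
   ever evaluate it on [ud]. *)
Definition ud_dual : set (fct -> R[i]) :=
  [set u | linear_on_ud u /\ continuous_on_ud u].

Definition ud_embed f : fct -> R[i] :=
  fun phi => torus_integral (fun x => f x * phi x).

Definition dual_in_ud u :=
  exists2 f, ud f & forall phi, ud phi -> u phi = ud_embed f phi.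

End Ultradifferentiable.

Section DualOperators.
Variables (R : realType) (d : nat).
Local Notation fct := ('rV[R]_d -> R[i]).

Definition dual_partial (i : 'I_d) (u : fct -> R[i]) : fct -> R[i] :=
  fun phi => - u (cpartial i phi).

Definition dual_mul (b : fct) (u : fct -> R[i]) : fct -> R[i] :=
  fun phi => u (fun x => b x * phi x).

End DualOperators.

(* Points of T^(N+1) are rows (t_1, ..., t_N, x). *)
Definition t_coord (N : nat) (j : 'I_N) : 'I_N.+1 := widen_ord (leqnSn N) j.
Definition x_coord (N : nat) : 'I_N.+1 := ord_max.

Section Systems.
Variables (R : realType) (N : nat).
Local Notation fct := ('rV[R]_N.+1 -> R[i]).

(* \partial_{t_j} + b \partial_x *)
Definition vector_field (j : 'I_N) (b : fct) (u : fct -> R[i]) : fct -> R[i] :=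
  fun phi => dual_partial (t_coord j) u phi +
             dual_mul b (dual_partial (x_coord N) u) phi.

Definition globally_hypoelliptic (m : nat -> R)
    (Q : 'I_N -> (fct -> R[i]) -> (fct -> R[i])) :=
  forall u, ud_dual m u -> (forall j, dual_in_ud m (Q j u)) -> dual_in_ud m u.

End Systems.

Definition mean (R : realType) (a : R -> R) : R :=
  (2 * pi)^-1 * \int[lebesgue_measure]_(s in `[0, 2 * pi]) a s.

(* Main.v *)
Require Import Defs.
From mathcomp Require Import all_boot all_order all_algebra.
From mathcomp Require Import all_classical all_reals all_analysis.
From mathcomp Require Import ring lra.
Set Implicit Arguments.
Unset Strict Implicit.
Unset Printing Implicit Defensive.
Import Order.TTheory GRing.Theory Num.Theory.
Import numFieldNormedType.Exports.
Import Normc.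
Local Open Scope classical_set_scope.
Local Open Scope ring_scope.
Local Open Scope complex_scope.

(** The two systems are conjugate. Let [A_j] be a primitive of [a_j - a_j0];
  it is [2 pi]-periodic because its derivative has mean zero. The shear
  [S (t, x) = (t, x + G t)] with [G t = \sum_j A_j (t_j)] is a diffeomorphism of
  the torus, and the chain rule reads
  [(d/dt_j + a_j0 d/dx) (phi o S) = ((d/dt_j + a_j d/dx) phi) o S],
  so composition with [S] intertwines the two systems. It transports global
  hypoellipticity from one system to the other, and the shear by [- G] goes
  back, once three facts are established.

  - Composition with [S] preserves the ultradifferentiable class, with
    estimates ([dbound_shear], [real_ud_shear_bound]). By the chain rule a
    derivative of [phi o S] is, up to composition with [S], an iterate on [phi]
    of the fields [d_i + (d_i G) d_x]. If the derivatives of order [n] of a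
    function are at most [D w_(n+p)], where [w_n = h^n m_n n!], then those of
    its image under such a field are at most [D K w_(n+p+1)] with [K] independent
    of [n] and [p] ([dbound_shear_field]): as [m_j m_k <= m_(j+k)], the Leibniz
    sum is dominated by a geometric series as soon as [h] is twice the radius of
    the derivatives of [G]. Hence the radius [h] of [phi] becomes [K h], and no
    formula for the higher derivatives of a composition enters.

  - Composition with [S] is thus continuous for the inductive limit topology and
    acts on the dual by transposition ([ud_dual_shear]).

  - It preserves the torus integral ([torus_integral_real_shear]): at fixed [t]
    it is a translation in [x], the variable which is integrated first. Hence
    the action on the dual extends the one on functions ([ud_embed_shear]).

  The estimates handle words in the partial derivatives of the real and
  imaginary parts, while the seminorms are defined with multi-indices, that is
  sorted words; commutation of partial derivatives ([derive_comm]) relates the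
  two. *)

(** * Directional derivatives along lines *)

Section Lines.
Variables (R : realType) (V : normedModType R).
Implicit Types (g : V -> R) (x u v : V).

Lemma is_derive_line g x v (s : R) : derivable g (x + s *: v) v ->
  is_derive s 1 (fun r : R => g (x + r *: v)) ('D_v g (x + s *: v)).
Proof.
have E : (fun h : R => h^-1 *: (g (x + (h *: (1 : R) + s) *: v)
    - g (x + s *: v))) = (fun h => h^-1 *: (g (h *: v + (x + s *: v)) - g (x + s *: v))).
  apply/funext => h; congr (_ *: (g _ - _)).
  by rewrite scalerDl scaler1 addrCA.
move=> dg; apply: DeriveDef; first by rewrite /derivable E.
by rewrite /derive E.
Qed.

Lemma MVT_line g x v (s : R) : (forall y, derivable g y v) ->
  exists2 r : R, `|r| <= `|s| & g (x + s *: v) - g x = s * 'D_v g (x + r *: v).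
Proof.
move=> dg.
pose F (r : R) := g (x + r *: v).
have dF (r : R) : is_derive r (1 : R) F ('D_v g (x + r *: v)) by apply: is_derive_line.
have cF : continuous F.
  move=> r; apply: differentiable_continuous; apply/derivable1_diffP.
  by case: (dF r).
have F0 : g x = F 0 by rewrite /F scale0r addr0.
have [s0|s0] := leP 0 s.
  have [c cI Ec] := MVT_segment s0 (fun r _ => dF r) (continuous_subspaceT cF).
  exists c; last by rewrite F0 -/(F s) Ec subr0 mulrC.
  move: cI; rewrite in_itv/= => /andP[c0 cs].
  by rewrite !ger0_norm.
have [c cI Ec] := MVT_segment (ltW s0) (fun r _ => dF r) (continuous_subspaceT cF).
exists c.
  move: cI; rewrite in_itv/= => /andP[c0 cs].
  by rewrite !ler0_norm ?lerN2// ltW.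
by rewrite F0 -/(F s) -opprB Ec sub0r mulrN opprK mulrC.
Qed.

(** The second difference of [g] along [u] and [v] is symmetric in [u] and [v];
  two applications of the mean value theorem turn it into a value of either
  mixed derivative near [x], times the square of the step. *)
Lemma derive_comm g u v x :
  (forall y, derivable g y u) -> (forall y, derivable g y v) ->
  (forall y, derivable ('D_u g) y v) -> (forall y, derivable ('D_v g) y u) ->
  {for x, continuous ('D_v ('D_u g))} -> {for x, continuous ('D_u ('D_v g))} ->
  'D_v ('D_u g) x = 'D_u ('D_v g) x.
Proof.
move=> du dv duv dvu cuv cvu.
have key (w1 w2 : V) (s : R) :
    (forall y, derivable g y w1) -> (forall y, derivable ('D_w1 g) y w2) ->
    exists a b : R, [/\ `|a| <= `|s|, `|b| <= `|s| &
    g (x + s *: w2 + s *: w1) - g (x + s *: w2) - (g (x + s *: w1) - g x) =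
    s * (s * 'D_w2 ('D_w1 g) (x + a *: w1 + b *: w2))].
  move=> d1 d12.
  (* The second difference is the increment of a first difference. *)
  pose F y := g (y + s *: w2) - g y.
  have sh y : is_derive y w1 (fun z => g (z + s *: w2)) ('D_w1 g (y + s *: w2)).
    have E : (fun h : R => h^-1 *: (g (h *: w1 + y + s *: w2) - g (y + s *: w2)))
        = (fun h => h^-1 *: (g (h *: w1 + (y + s *: w2)) - g (y + s *: w2))).
      by apply/funext => h; rewrite addrA.
    apply: DeriveDef; first by rewrite /derivable E; exact: d1.
    by rewrite /derive E.
  have dF y : is_derive y w1 F ('D_w1 g (y + s *: w2) - 'D_w1 g y).
    by apply: is_deriveB; exact: derivableP.
  have [a ha Ea] := @MVT_line F x w1 s (fun y => @ex_derive _ _ _ _ _ _ _ (dF y)).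
  have [b hb Eb] := @MVT_line ('D_w1 g) (x + a *: w1) w2 s d12.
  exists a, b; split => //.
  have DE : 'D_w1 F (x + a *: w1) =
     'D_w1 g (x + a *: w1 + s *: w2) - 'D_w1 g (x + a *: w1).
    exact: derive_val.
  rewrite -Eb -DE -Ea /F (addrAC x); ring.
apply/eqP; rewrite -subr_eq0 -normr_le0; apply/ler_addgt0Pr => e e0.
rewrite add0r.
have e2 : 0 < e / 2 by rewrite divr_gt0.
have H1 : \forall y \near x, `|'D_v ('D_u g) x - 'D_v ('D_u g) y| < e / 2.
  by move/cvgrPdist_lt : cuv; apply.
have H2 : \forall y \near x, `|'D_u ('D_v g) x - 'D_u ('D_v g) y| < e / 2.
  by move/cvgrPdist_lt : cvu; apply.
have /(@nbhs_ballP R V)[dl /= dl0 Hb] :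
    nbhs x [set y | `|'D_v ('D_u g) x - 'D_v ('D_u g) y| < e / 2 /\
                    `|'D_u ('D_v g) x - 'D_u ('D_v g) y| < e / 2].
  by apply: filterS2 H1 H2 => y h1 h2; split.
(* With this step the intermediate points stay in the ball of radius [dl]. *)
pose s := dl / (`|u| + `|v| + 1).
have D0 : 0 < `|u| + `|v| + 1 by rewrite ltr_wpDl// addr_ge0.
have s0 : 0 < s by rewrite divr_gt0.
have near_x (a b : R) : `|a| <= `|s| -> `|b| <= `|s| -> ball x dl (x + a *: u + b *: v).
  move=> ha hb; rewrite -ball_normE /= -addrA opprD addrA subrr sub0r normrN.
  rewrite (le_lt_trans (ler_normD _ _))// !normrZ.
  rewrite (@le_lt_trans _ _ (s * (`|u| + `|v|)))//.
    rewrite mulrDr lerD// ler_wpM2r//; [move: ha|move: hb]; by rewrite (gtr0_norm s0).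
  rewrite /s mulrAC ltr_pdivrMr// ltr_pM2l// ltrDl//.
have [a [b [ha hb E1]]] := key u v s du duv.
have [a' [b' [ha' hb' E2]]] := key v u s dv dvu.
have [B1 _] := Hb _ (near_x a b ha hb).
have [_ B2] := Hb _ (near_x b' a' hb' ha').
rewrite (addrAC _ (b' *: u)) in B2.
have Emid : 'D_v ('D_u g) (x + a *: u + b *: v) = 'D_u ('D_v g) (x + a' *: v + b' *: u).
  apply: (mulfI (lt0r_neq0 s0)); apply: (mulfI (lt0r_neq0 s0)).
  rewrite -E1 -E2 (addrAC x) !opprB; ring.
rewrite -Emid in B2.
apply: (le_trans (ler_distD ('D_v ('D_u g) (x + a *: u + b *: v)) _ _)).
rewrite [leRHS]splitr; apply: lerD; apply: ltW; first exact: B1.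
by rewrite distrC; exact: B2.
Qed.

(** The increment is split along the two directions and the mean value theorem
  is applied to each part, so that continuous partial derivatives suffice. *)
Lemma cvg_chain2 g u v x (rho : R -> R) (l : R) :
  (forall y, derivable g y u) -> (forall y, derivable g y v) ->
  {for x, continuous ('D_u g)} -> {for x, continuous ('D_v g)} ->
  (fun h : R => h^-1 * rho h) @ 0^' --> l ->
  (fun h : R => h^-1 *: (g (x + h *: u + rho h *: v) - g x)) @ 0^'
    --> 'D_u g x + l * 'D_v g x.
Proof.
move=> du dv cu cv hl.
have h0 : (fun h : R => h) @ 0^' --> (0 : R).
  by move=> A hA; exact: cvg_within hA.
have hrho : rho @ 0^' --> (0 : R).
  rewrite -[X in _ --> X](mul0r l).
  have : (fun h : R => h * (h^-1 * rho h)) @ 0^' --> 0 * l by exact: (cvgM h0 hl).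
  apply: cvg_trans; apply: near_eq_cvg; near=> h.
  by rewrite mulrA mulfV ?mul1r//; near: h; exact: nbhs_dnbhs_neq.
have /choice[a Ha] : forall h : R, exists a : R, `|a| <= `|h| /\
    g (x + rho h *: v + h *: u) - g (x + rho h *: v)
      = h * 'D_u g (x + rho h *: v + a *: u).
  by move=> h; have [a] := MVT_line (x + rho h *: v) h du; exists a.
have /choice[b Hb] : forall h : R, exists b : R, `|b| <= `|rho h| /\
    g (x + rho h *: v) - g x = rho h * 'D_v g (x + b *: v).
  by move=> h; have [b] := MVT_line x (rho h) dv; exists b.
have ca : a @ 0^' --> (0 : R).
  apply/cvgr0Pnorm_lt => e e0; move/cvgr0Pnorm_lt : h0 => /(_ _ e0).
  by apply: filterS => h; apply: le_lt_trans; case: (Ha h).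
have cb : b @ 0^' --> (0 : R).
  apply/cvgr0Pnorm_lt => e e0; move/cvgr0Pnorm_lt : hrho => /(_ _ e0).
  by apply: filterS => h; apply: le_lt_trans; case: (Hb h).
have ta : (fun h => x + rho h *: v + a h *: u) @ 0^' --> x.
  rewrite -[X in _ --> X]addr0 -(scale0r u) -[X in _ --> X + _]addr0 -(scale0r v).
  by apply: cvgD; [apply: cvgD; [exact: cvg_cst|exact: cvgZr_tmp]|exact: cvgZr_tmp].
have tb : (fun h => x + b h *: v) @ 0^' --> x.
  rewrite -[X in _ --> X]addr0 -(scale0r v).
  by apply: cvgD; [exact: cvg_cst|exact: cvgZr_tmp].
have : (fun h => 'D_u g (x + rho h *: v + a h *: u)
    + (h^-1 * rho h) * 'D_v g (x + b h *: v)) @ 0^' --> 'D_u g x + l * 'D_v g x.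
  apply: cvgD; first exact: (continuous_cvg _ cu ta).
  by apply: cvgM => //; exact: (continuous_cvg _ cv tb).
apply: cvg_trans; apply: near_eq_cvg; near=> h.
have hn0 : h != 0 by near: h; exact: nbhs_dnbhs_neq.
have -> : g (x + h *: u + rho h *: v) - g x =
    h * 'D_u g (x + rho h *: v + a h *: u) + rho h * 'D_v g (x + b h *: v).
  by rewrite -(Ha h).2 -(Hb h).2 subrKA (addrAC x).
by rewrite scalerDr /GRing.scale/= !mulrA mulVf// mul1r.
Unshelve. all: by end_near. Qed.

End Lines.

(** * Partial derivatives and shears *)

Section Words.
Variables (R : realType) (d : nat).
Implicit Types (f g : 'rV[R]_d -> R) (i j k : 'I_d) (s : seq 'I_d).

Definition pd i g : 'rV[R]_d -> R := 'D_(delta_mx ord0 i) g.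

Definition pds s g := foldr pd g s.

Definition rsmooth g := forall s, continuous (pds s g) /\
  forall i x, derivable (pds s g) x (delta_mx ord0 i).

(** The recursion on words in [rsmooth] removes the outermost derivative, while
  products and compositions expand from the innermost one; [class_C] is the recursion
  suited to them. *)
Fixpoint class_C n g : Prop := continuous g /\
  if n is n'.+1 then
    (forall i x, derivable g x (delta_mx ord0 i)) /\ forall i, class_C n' (pd i g)
  else True.

Lemma pds_rcons s i g : pds (rcons s i) g = pds s (pd i g).
Proof. by rewrite /pds foldr_rcons. Qed.

Lemma pds_cat s t g : pds (s ++ t) g = pds s (pds t g).
Proof. by rewrite /pds foldr_cat. Qed.

Lemma rsmooth_pd i g : rsmooth g -> rsmooth (pd i g).
Proof. by move=> sg s; have := sg (rcons s i); rewrite pds_rcons. Qed.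

Lemma rsmooth_pds s g : rsmooth g -> rsmooth (pds s g).
Proof. by move=> sg t; have := sg (t ++ s); rewrite pds_cat. Qed.

Lemma rsmoothP g : rsmooth g <-> forall n, class_C n g.
Proof.
split=> [sg n|].
  elim: n g sg => [|n IHn] g sg; have [cg dg] := sg [::]; split=> //.
  by split=> // i; apply/IHn/rsmooth_pd.
move=> cg s; elim/last_ind: s g cg => [|s i IHs] g cg.
  by have [? [? _]] := cg 1%N.
rewrite pds_rcons; apply: IHs => n.
by have [_ [_]] := cg n.+1; apply.
Qed.

Lemma rsmooth_continuous g : rsmooth g -> continuous g.
Proof. by move=> /(_ [::])[]. Qed.

Lemma rsmooth_derivable g i x : rsmooth g -> derivable g x (delta_mx ord0 i).
Proof. by move=> /(_ [::])[_]; apply. Qed.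

Lemma pd_comm i j g : rsmooth g -> pd i (pd j g) = pd j (pd i g).
Proof.
move=> sg; apply/funext => x; apply: derive_comm => [y|y|y|y||].
- by have [_] := sg [::]; apply.
- by have [_] := sg [::]; apply.
- by have [_] := sg [:: j]; apply.
- by have [_] := sg [:: i]; apply.
- by have [+ _] := sg [:: i; j]; apply.
- by have [+ _] := sg [:: j; i]; apply.
Qed.

Lemma pds_perm s t g : rsmooth g -> perm_eq s t -> pds s g = pds t g.
Proof.
move=> sg; elim: s t => [|i s IHs] t.
  by move=> /perm_size/esym/size0nil ->.
move=> st; have it : i \in t by rewrite -(perm_mem st) mem_head.
case/splitPr: t / it st => t1 t2 st.
have {}st : perm_eq s (t1 ++ t2).
  by rewrite -(perm_cons i) (permPl st) perm_catC /= perm_cons perm_catC.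
rewrite /= (IHs _ st) {st}; elim: t1 => //= j t1 IHt.
by rewrite pd_comm ?IHt//; exact: rsmooth_pds.
Qed.

Lemma pdD i f g : (forall x, derivable f x (delta_mx ord0 i)) ->
  (forall x, derivable g x (delta_mx ord0 i)) -> pd i (f + g) = pd i f + pd i g.
Proof. by move=> df dg; apply/funext => x; rewrite /pd deriveD. Qed.

Lemma pdM i f g : (forall x, derivable f x (delta_mx ord0 i)) ->
  (forall x, derivable g x (delta_mx ord0 i)) ->
  pd i (f * g) = f * pd i g + g * pd i f.
Proof. by move=> df dg; apply/funext => x; rewrite /pd deriveM. Qed.

Lemma pd_cst i (c : R) : pd i (cst c) = cst 0.
Proof. by apply/funext => x; rewrite /pd derive_cst. Qed.

Lemma class_C_weaken n g : class_C n.+1 g -> class_C n g.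
Proof.
elim: n g => [|n IHn] g [cg [dg hg]]; split=> //.
by split=> // i; apply: IHn.
Qed.

Lemma class_C_cst n (c : R) : class_C n (cst c).
Proof.
elim: n c => [|n IHn] c; (split; first by move=> x; exact: cst_continuous) => //.
by split=> [i x|i]; [exact: derivable_cst|rewrite pd_cst].
Qed.

Lemma class_CD n f g : class_C n f -> class_C n g -> class_C n (f + g).
Proof.
elim: n f g => [|n IHn] f g [cf hf] [cg hg]; split=> //;
  try by move=> x; apply: continuousD; [exact: cf|exact: cg].
case: hf hg => [df hf] [dg hg]; split=> [i x|i]; first exact: derivableD.
rewrite pdD => [|x|x]; [|exact: df|exact: dg].
by apply: IHn; [exact: hf|exact: hg].
Qed.

Lemma class_CM n f g : class_C n f -> class_C n g -> class_C n (f * g).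
Proof.
elim: n f g => [|n IHn] f g hf hg; have [cf df] := hf; have [cg dg] := hg.
  by split=> // x; apply: continuousM; [exact: cf|exact: cg].
split; first by move=> x; apply: continuousM; [exact: cf|exact: cg].
split=> [i x|i]; first by apply: derivableM; [apply: df.1|apply: dg.1].
rewrite pdM => [|x|x]; [|exact: df.1|exact: dg.1].
apply: class_CD; apply: IHn; [exact: class_C_weaken|exact: dg.2|exact: class_C_weaken|exact: df.2].
Qed.

Lemma rsmooth_cst (c : R) : rsmooth (cst c).
Proof. by apply/rsmoothP => n; exact: class_C_cst. Qed.

Lemma rsmoothD f g : rsmooth f -> rsmooth g -> rsmooth (f + g).
Proof. by move=> /rsmoothP sf /rsmoothP sg; apply/rsmoothP => n; exact: class_CD. Qed.

Lemma rsmoothM f g : rsmooth f -> rsmooth g -> rsmooth (f * g).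
Proof. by move=> /rsmoothP sf /rsmoothP sg; apply/rsmoothP => n; exact: class_CM. Qed.

Section Shear.
Variables (k : 'I_d) (G : 'rV[R]_d -> R).
Let ek : 'rV[R]_d := delta_mx ord0 k.

Definition shear (z : 'rV[R]_d) : 'rV[R]_d := z + G z *: delta_mx ord0 k.

(** The field whose action, followed by composition with the shear, is the
  [i]-th partial derivative of the composition. *)
Definition shear_field i g := pd i g + pd i G * pd k g.

Lemma shear_fieldE i g z : shear_field i g z = pd i g z + pd i G z * pd k g z.
Proof. by []. Qed.

Hypothesis Gk : forall z r, G (z + r *: delta_mx ord0 k) = G z.
Hypothesis sG : rsmooth G.

Lemma shear_continuous : continuous shear.
Proof.
move=> z; apply: (@continuousD R _ _ id (fun z => G z *: ek)) => /=.
  by move=> A.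
by apply: continuousZr_tmp; exact: (rsmooth_continuous sG).
Qed.

(** The shear moves points along a direction in which [G] is constant. *)
Lemma pd_shear_inv i z : pd i G (shear z) = pd i G z.
Proof.
have E : (fun h : R => h^-1 *: (G (h *: delta_mx ord0 i + shear z) - G (shear z)))
    = (fun h : R => h^-1 *: (G (h *: delta_mx ord0 i + z) - G z)).
  by apply/funext => h; rewrite /shear Gk addrA Gk.
by rewrite /pd /derive E.
Qed.

(** Along the [i]-th axis the sheared point moves by [h] in direction [i] and by
  the increment of [G] in direction [k]: the setting of [cvg_chain2]. *)
Lemma is_derive_shear i g z : class_C 1 g ->
  is_derive z (delta_mx ord0 i) (g \o shear) (shear_field i g (shear z)).
Proof.
move=> [cg [dg hg]].
pose rho (h : R) := G (h *: delta_mx ord0 i + z) - G z.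
have hl : (fun h : R => h^-1 * rho h) @ 0^' --> pd i G z.
  exact: (rsmooth_derivable (i := i) (x := z) sG).
have /= H := cvg_chain2 (dg i) (dg k)
  ((hg i).1 (shear z)) ((hg k).1 (shear z)) hl.
have E : (fun h : R => h^-1 *: ((g \o shear) (h *: delta_mx ord0 i + z)
    - (g \o shear) z)) = (fun h : R => h^-1 *: (g (shear z + h *: delta_mx ord0 i
    + rho h *: delta_mx ord0 k) - g (shear z))).
  apply/funext => h; rewrite /= ; congr (_ *: (g _ - _)).
  rewrite /shear /rho scalerBl !addrA (addrC (h *: _)).
  by rewrite (addrAC _ (G z *: _)) addrAC addrK.
rewrite shear_fieldE pd_shear_inv.
apply: DeriveDef; first by rewrite /derivable E; apply/cvg_ex; eexists; exact: H.
by rewrite /derive E; exact: cvg_lim H.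
Qed.

Lemma pd_shear i g : class_C 1 g -> pd i (g \o shear) = shear_field i g \o shear.
Proof.
by move=> hg; apply/funext => z; have := is_derive_shear i z hg; case.
Qed.

Lemma class_C_shear n g : class_C n g -> class_C n (g \o shear).
Proof.
elim: n g => [|n IHn] g hg.
  by split=> // x; apply: continuous_comp; [exact: shear_continuous|exact: hg.1].
have h1 : class_C 1 g.
  by case: hg => [? [? hg]]; split=> //; split=> // i; case: n hg {IHn} => [|n] /(_ i)[].
split.
  by move=> x; apply: continuous_comp; [exact: shear_continuous|exact: hg.1].
split=> [i x|i]; first by case: (is_derive_shear i x h1).
rewrite pd_shear//; apply: IHn; case: hg => [_ [_ hg]].
apply: class_CD; first exact: hg.
apply: class_CM; last exact: hg.
by move/rsmoothP : (rsmooth_pd i sG); apply.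
Qed.

Lemma rsmooth_shear g : rsmooth g -> rsmooth (g \o shear).
Proof. by move=> /rsmoothP hg; apply/rsmoothP => n; exact: class_C_shear. Qed.

Lemma rsmooth_shear_field i g : rsmooth g -> rsmooth (shear_field i g).
Proof.
move=> sg; apply: rsmoothD; first exact: rsmooth_pd.
by apply: rsmoothM; exact: rsmooth_pd.
Qed.

Lemma pds_shear s g : rsmooth g ->
  rsmooth (foldr shear_field g s) /\ pds s (g \o shear) = foldr shear_field g s \o shear.
Proof.
move=> sg; elim: s => [|i s [IHs IHe]] //=.
split; first exact: rsmooth_shear_field.
by rewrite IHe pd_shear//; move/rsmoothP : IHs.
Qed.

End Shear.
End Words.

(** * Derivative bounds and weight sequences *)

Section Weights.
Variables (R : realType) (m : nat -> R).
Hypothesis hm : weight_sequence m.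

(** By log-convexity the ratios [m n.+1 / m n] increase with [n], and
  [m (l + q) / m q] is a product of [l] of them which start at rank [q], while
  [m l] is the product of those which start at rank [0]. *)
Lemma weight_mul l q : m l * m q <= m (l + q)%N.
Proof.
have m0 := weight_gt0 hm.
have ratio n : m n.+1 / m n <= m n.+2 / m n.+1.
  rewrite ler_pdivrMr// mulrAC ler_pdivlMr// -expr2 (mulrC (m n.+2)).
  exact: (weight_logconvex hm (ltn0Sn n)).
have ratioD n p : m n.+1 / m n <= m (n + p).+1 / m (n + p)%N.
  elim: p => [|p IHp]; first by rewrite addn0.
  by rewrite addnS; apply: le_trans IHp _.
elim: l => [|l IHl]; first by rewrite (weight_0 hm) mul1r.
have := ler_pM (ltW (divr_gt0 (m0 l.+1) (m0 l)))
  (ltW (mulr_gt0 (m0 l) (m0 q))) (ratioD l q) IHl.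
by rewrite mulrA divfK ?gt_eqF// divfK ?gt_eqF// addSn.
Qed.

Lemma ud_weight_gt0 h n : 0 < h -> 0 < ud_weight m h n.
Proof.
by move=> h0; rewrite /ud_weight !mulr_gt0 ?exprn_gt0 ?ltr0n ?fact_gt0 ?(weight_gt0 hm).
Qed.

Lemma ud_weight_le h1 h2 n : 0 < h1 -> h1 <= h2 ->
  ud_weight m h1 n <= ud_weight m h2 n.
Proof.
move=> h10 h12; rewrite /ud_weight !ler_wpM2r ?ler0n ?(ltW (weight_gt0 hm _))//.
by rewrite lerXn2r// nnegrE ?(ltW h10)// (le_trans (ltW h10)).
Qed.

(** With ['C(n + p, l)] in place of ['C(n, l)] this would be an equality. *)
Lemma bin_fact_le n l p : (l <= n)%N ->
  ('C(n, l) * (l`! * (n - l + p)`!) <= (n + p)`!)%N.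
Proof.
move=> ln; have lnp : (l <= n + p)%N by rewrite (leq_trans ln)// leq_addr.
rewrite -(bin_fact lnp) addnBAC// leq_mul2r leq_bin2l ?orbT//.
exact: leq_addr.
Qed.

(** The first factor has at most half the radius of the second: this gains the
  power of [2^-1] which makes the Leibniz sum geometric. *)
Lemma ud_weight_term hb h n l p : 0 < hb -> hb <= h / 2 -> (l <= n)%N ->
  'C(n, l)%:R * (ud_weight m hb l * ud_weight m h (n - l + p)) <=
  2^-1 ^+ l * ud_weight m h (n + p).
Proof.
move=> hb0 hbh ln; have h0 : 0 < h by lra.
rewrite /ud_weight.
set N := (n - l + p)%N; set M := (n + p)%N.
have MN : M = (l + N)%N by rewrite /M /N addnA subnKC.
rewrite (_ : _ * _ = (hb ^+ l * h ^+ N) * (m l * m N) *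
  ('C(n, l) * (l`! * N`!))%:R); last by rewrite !natrM; ring.
rewrite (_ : 2^-1 ^+ l * _ = (2^-1 ^+ l * h ^+ M) * m M * M`!%:R); last by ring.
have mm : m l * m N <= m M by rewrite MN weight_mul.
have ml0 := weight_gt0 hm l; have mN0 := weight_gt0 hm N.
have hl0 : 0 <= hb ^+ l * h ^+ N.
  by rewrite mulr_ge0// exprn_ge0// ltW.
have mm0 : 0 <= m l * m N by rewrite mulr_ge0// ltW.
apply: ler_pM; [exact: mulr_ge0|exact: ler0n| |by rewrite ler_nat bin_fact_le].
apply: ler_pM => //.
rewrite MN exprD mulrA ler_pM2r ?exprn_gt0// -exprMn (mulrC _ h).
by rewrite lerXn2r// nnegrE ?(ltW hb0)// ltW// (lt_le_trans hb0).
Qed.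

(** The bound for the derivatives of order [n] of a product of two factors whose
  derivatives are bounded by [c] and [e]. *)
Definition leibniz (c e : nat -> R) n : R :=
  \sum_(l < n.+1) 'C(n, l)%:R * (c l * e (n - l)%N).

(** Pascal's rule, in the form in which differentiating a product produces it. *)
Lemma leibnizS c e n : leibniz (c \o succn) e n + leibniz c (e \o succn) n =
  leibniz c e n.+1.
Proof.
rewrite /leibniz [RHS]big_ord_recl.
under [X in _ = _ + X]eq_bigr do rewrite lift0 binS natrD mulrDl subSS.
rewrite big_split /= [LHS]addrC addrA; congr (_ + _).
have -> : \sum_(l < n.+1) 'C(n, l)%:R * (c l * e (n - l).+1) =
    \sum_(l < n.+2) 'C(n, l)%:R * (c l * e (n.+1 - l)%N).
  rewrite [RHS]big_ord_recr /= bin_small// mul0r addr0.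
  by apply: eq_bigr => l _; rewrite subSn// -ltnS.
by rewrite big_ord_recl !bin0; congr (_ + _); apply: eq_bigr => l _; rewrite lift0 subSS.
Qed.

Lemma geometric_half n : \sum_(l < n) (2^-1 : R) ^+ l <= 2.
Proof.
suff -> : \sum_(l < n) (2^-1 : R) ^+ l = 2 - 2 * 2^-1 ^+ n.
  by rewrite gerBl mulr_ge0// exprn_ge0// invr_ge0.
elim: n => [|n IHn]; first by rewrite big_ord0 expr0 mulr1 subrr.
by rewrite big_ord_recr /= IHn exprS; field.
Qed.

Lemma leibniz_weight hb h B D p n : 0 < hb -> hb <= h / 2 -> 0 <= B -> 0 <= D ->
  leibniz (fun l => B * ud_weight m hb l) (fun q => D * ud_weight m h (q + p)) n
  <= 2 * B * (D * ud_weight m h (n + p)).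
Proof.
move=> hb0 hbh B0 D0; have h0 : 0 < h by lra.
apply: (@le_trans _ _ (\sum_(l < n.+1)
    2^-1 ^+ l * (B * (D * ud_weight m h (n + p))))).
  apply: ler_sum => l _.
  rewrite [leLHS](_ : _ = (B * D) * ('C(n, l)%:R *
    (ud_weight m hb l * ud_weight m h (n - l + p)))); last by ring.
  rewrite [leRHS](_ : _ = (B * D) * (2^-1 ^+ l * ud_weight m h (n + p)));
    last by ring.
  by rewrite ler_wpM2l ?mulr_ge0// ud_weight_term// -ltnS.
have w0 : 0 <= ud_weight m h (n + p) by apply: ltW; exact: ud_weight_gt0.
by rewrite -mulr_suml -mulrA ler_wpM2r ?geometric_half// mulr_ge0// mulr_ge0.
Qed.

End Weights.

Section Bounds.
Variables (R : realType) (d : nat).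
Implicit Types (f g : 'rV[R]_d -> R) (i j k : 'I_d) (s : seq 'I_d)
  (c e : nat -> R).

Definition dbound g c := forall s x, `|pds s g x| <= c (size s).

Lemma dbound_pd i g c : dbound g c -> dbound (pd i g) (c \o succn).
Proof. by move=> gc s x; rewrite -pds_rcons (le_trans (gc _ _))// size_rcons. Qed.

Lemma dbound_le g c e : (forall n, c n <= e n) -> dbound g c -> dbound g e.
Proof. by move=> ce gc s x; rewrite (le_trans (gc s x)). Qed.

Lemma pdsD s f g : rsmooth f -> rsmooth g -> pds s (f + g) = pds s f + pds s g.
Proof.
move=> sf sg; elim: s => //= i s ->; rewrite pdD// => x.
- by apply: rsmooth_derivable; exact: rsmooth_pds.
- by apply: rsmooth_derivable; exact: rsmooth_pds.
Qed.

Lemma dboundD f g c e : rsmooth f -> rsmooth g -> dbound f c -> dbound g e ->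
  dbound (f + g) (fun n => c n + e n).
Proof.
move=> sf sg fc ge s x; rewrite pdsD//.
by rewrite (le_trans (ler_normD _ _))// lerD.
Qed.

Lemma dboundM f g c e : rsmooth f -> rsmooth g -> dbound f c -> dbound g e ->
  dbound (f * g) (leibniz c e).
Proof.
move=> sf sg fc ge s; elim/last_ind: s f g c e sf sg fc ge => [|s i IHs] f g c e sf sg fc ge x.
  rewrite /leibniz big_ord1 bin0 mul1r /= normrM.
  by apply: ler_pM => //; [exact: (fc [::])|exact: (ge [::])].
rewrite size_rcons -leibnizS pds_rcons pdM; last 2 first.
  by move=> y; exact: rsmooth_derivable.
  by move=> y; exact: rsmooth_derivable.
have sfi := rsmooth_pd i sf; have sgi := rsmooth_pd i sg.
rewrite pdsD; [|exact: rsmoothM..].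
rewrite addrC (le_trans (ler_normD _ _))// lerD//.
  by rewrite mulrC; apply: IHs => //; exact: dbound_pd.
by apply: IHs => //; exact: dbound_pd.
Qed.

Variable m : nat -> R.
Hypothesis hm : weight_sequence m.
Variables (k : 'I_d) (G : 'rV[R]_d -> R) (B hb : R).
Hypothesis Gk : forall z r, G (z + r *: delta_mx ord0 k) = G z.
Hypothesis sG : rsmooth G.
Hypothesis B0 : 0 <= B.
Hypothesis hb0 : 0 < hb.
Hypothesis GB : forall i, dbound (pd i G) (fun n => B * ud_weight m hb n).

(** The key estimate: one application of a sheared field costs one order of
  derivation and a factor which depends neither on [n] nor on [p], so it can be
  iterated without loss on the radius. *)
Lemma dbound_shear_field i g D h p : hb <= h / 2 -> 0 <= D -> rsmooth g ->
  dbound g (fun n => D * ud_weight m h (n + p)) ->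
  dbound (shear_field k G i g) (fun n => D * (1 + 2 * B) * ud_weight m h (n + p.+1)).
Proof.
move=> hbh D0 sg gD.
have gD' j : dbound (pd j g) (fun n => D * ud_weight m h (n + p.+1)).
  by apply: dbound_le (dbound_pd j gD) => n /=; rewrite addSnnS.
have := dboundD (rsmooth_pd i sg)
  (rsmoothM (rsmooth_pd i sG) (rsmooth_pd k sg)) (gD' i)
  (dboundM (rsmooth_pd i sG) (rsmooth_pd k sg) (GB i) (gD' k)).
apply: dbound_le => n.
apply: (le_trans (lerD (lexx _) (leibniz_weight hm p.+1 n hb0 hbh B0 D0))).
by rewrite le_eqVlt; apply/orP; left; apply/eqP; ring.
Qed.

(** A factor for each derivative is a dilation of the radius. *)
Lemma dbound_shear g C h : hb <= h / 2 -> 0 <= C -> rsmooth g ->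
  dbound g (fun n => C * ud_weight m h n) ->
  dbound (g \o shear k G) (fun n => C * ud_weight m ((1 + 2 * B) * h) n).
Proof.
move=> hbh C0 sg gC s x; have [_ ->] := pds_shear Gk sG s sg.
suff H : dbound (foldr (shear_field k G) g s)
    (fun n => C * (1 + 2 * B) ^+ size s * ud_weight m h (n + size s)).
  apply: (le_trans (H [::] _)) => /=.
  rewrite le_eqVlt; apply/orP; left; apply/eqP.
  by rewrite /ud_weight exprMn add0n; ring.
elim: s => [|i s IHs] /=.
  by apply: dbound_le gC => n; rewrite addn0 expr0 mulr1.
have K0 : 0 <= 1 + 2 * B by rewrite addr_ge0// mulr_ge0.
have := dbound_shear_field i hbh (mulr_ge0 C0 (exprn_ge0 (size s) K0))
  (pds_shear Gk sG s sg).1 IHs.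
by apply: dbound_le => n; rewrite exprSr (mulrA C).
Qed.

End Bounds.

(** * Real ultradifferentiable functions on the torus *)

Section RealUd.
Variables (R : realType) (d : nat) (m : nat -> R).
Hypothesis hm : weight_sequence m.
Implicit Types (f g : 'rV[R]_d -> R) (i j k : 'I_d) (s : seq 'I_d).

Definition real_periodic g := forall i x, g (x + (2 * pi) *: delta_mx ord0 i) = g x.

Definition real_ud g := [/\ real_periodic g, rsmooth g & exists C h : R, [/\ 0 < C, 0 < h &
  dbound g (fun n => C * ud_weight m h n)]].

Lemma dbound_ud_weight_le g (C1 C2 h1 h2 : R) : 0 <= C1 -> C1 <= C2 ->
  0 < h1 -> h1 <= h2 -> dbound g (fun n => C1 * ud_weight m h1 n) ->
  dbound g (fun n => C2 * ud_weight m h2 n).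
Proof.
move=> C10 C12 h10 h12; apply: dbound_le => n.
apply: ler_pM => //; first exact/ltW/ud_weight_gt0.
exact: ud_weight_le.
Qed.

Lemma real_periodic_pd i g : real_periodic g -> real_periodic (pd i g).
Proof.
move=> pg j x; rewrite /pd /derive.
have E : (fun h : R => h^-1 *: (g (h *: delta_mx ord0 i + (x + (2 * pi) *: delta_mx ord0 j))
    - g (x + (2 * pi) *: delta_mx ord0 j)))
    = (fun h : R => h^-1 *: (g (h *: delta_mx ord0 i + x) - g x)).
  by apply/funext => h; rewrite addrA !pg.
by rewrite E.
Qed.

Lemma real_udD f g : real_ud f -> real_ud g -> real_ud (f + g).
Proof.
move=> [pf sf [C1 [h1 [C10 h10 b1]]]] [pg sg [C2 [h2 [C20 h20 b2]]]].
split; [by move=> i x; rewrite /= -[LHS]/(f _ + g _) pf pg|exact: rsmoothD|].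
pose h := Num.max h1 h2; exists (C1 + C2), h.
have h1h : h1 <= h by rewrite le_max lexx.
have h2h : h2 <= h by rewrite le_max lexx orbT.
split; [exact: addr_gt0|exact: lt_le_trans h1h|].
have b1' := dbound_ud_weight_le (ltW C10) (lexx _) h10 h1h b1.
have b2' := dbound_ud_weight_le (ltW C20) (lexx _) h20 h2h b2.
by apply: dbound_le (dboundD sf sg b1' b2') => n; rewrite mulrDl.
Qed.

Lemma real_udM f g : real_ud f -> real_ud g -> real_ud (f * g).
Proof.
move=> [pf sf [C1 [h1 [C10 h10 b1]]]] [pg sg [C2 [h2 [C20 h20 b2]]]].
split; [by move=> i x; rewrite /= -[LHS]/(f _ * g _) pf pg|exact: rsmoothM|].
(* The factor [2] makes room for the geometric series of [leibniz_weight]. *)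
pose h := Num.max (2 * h1) h2; exists (2 * C1 * C2), h.
have h1h : h1 <= h / 2 by rewrite ler_pdivlMr// mulrC le_max lexx.
have h2h : h2 <= h by rewrite le_max lexx orbT.
have h0 : 0 < h by exact: lt_le_trans h2h.
split; [by rewrite !mulr_gt0|exact: h0|].
have b2' : dbound g (fun n => C2 * ud_weight m h (n + 0)).
  by apply: dbound_le (dbound_ud_weight_le (ltW C20) (lexx _) h20 h2h b2) => n; rewrite addn0.
apply: dbound_le (dboundM sf sg b1 b2') => n.
by rewrite (le_trans (leibniz_weight hm 0 n h10 h1h (ltW C10) (ltW C20)))// addn0 mulrA.
Qed.

Lemma real_ud_cst (c : R) : real_ud (cst c).
Proof.
split; [by []|exact: rsmooth_cst|exists (`|c| + 1), 1; split=> //].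
have w0 n : 0 <= (`|c| + 1) * ud_weight m 1 n.
  by apply: mulr_ge0; [rewrite addr_ge0|apply: ltW; exact: ud_weight_gt0].
move=> s x; elim/last_ind: s => [|s i IHs]; last first.
  have p0 t : pds t (cst (0 : R)) = cst 0 :> ('rV[R]_d -> R).
    by elim: t => //= j t ->; rewrite pd_cst.
  by rewrite pds_rcons pd_cst p0 /= normr0.
by rewrite /ud_weight /= (weight_0 hm) expr0 fact0 !mulr1 lerDl.
Qed.

(** One more derivative is absorbed by moderate growth of the weight. *)
Lemma ud_weight_succ : exists2 K : R, 0 < K & forall (h : R) n, 0 < h ->
  ud_weight m h n.+1 <= K * h * ud_weight m (K * h) n.
Proof.
have [H H1 mH] := weight_moderate hm.
have H0 : 0 < H by lra.
exists (2 * H); first by rewrite mulr_gt0.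
move=> h n h0; rewrite /ud_weight factS.
have mn : m n.+1 <= H ^+ n.+1 * m n.
  by have := mH n 1%N; rewrite addn1 (weight_1 hm) mulr1.
have n2 : (n.+1%:R : R) <= 2 ^+ n.+1.
  by rewrite -natrX ler_nat ltnW// ltn_expl.
rewrite [leRHS](_ : _ = h ^+ n.+1 * (H ^+ n.+1 * m n) * (2 ^+ n.+1 * n`!%:R)); last first.
  by rewrite !exprMn !exprS; ring.
rewrite natrM; have m0 := weight_gt0 hm n.+1.
apply: ler_pM.
- by rewrite mulr_ge0 ?exprn_ge0// ltW.
- by rewrite mulr_ge0 ?ler0n.
- by rewrite ler_pM2l ?exprn_gt0.
- by rewrite ler_pM2r// ltr0n fact_gt0.
Qed.

Lemma real_ud_pd i g : real_ud g -> real_ud (pd i g).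
Proof.
move=> [pg sg [C [h [C0 h0 b]]]]; split; [exact: real_periodic_pd|exact: rsmooth_pd|].
have [K K0 HK] := ud_weight_succ.
exists (C * (K * h)), (K * h); split; [by rewrite !mulr_gt0|by rewrite mulr_gt0|].
apply: dbound_le (dbound_pd i b) => n /=.
by rewrite -[leRHS]mulrA ler_wpM2l ?(ltW C0)// HK.
Qed.

(** The shear by [G] is estimated through the derivatives of [G]. In this form
  the condition holds for a periodic primitive of an ultradifferentiable
  function without a bound on the values of the primitive. *)
Definition real_ud_grad G := [/\ real_periodic G, rsmooth G & forall i, real_ud (pd i G)].

Lemma real_ud_gradN G : real_ud_grad G -> real_ud_grad (- G).
Proof.
move=> [pG sG uG]; have -> : - G = cst (-1) * G.
  by apply/funext => x; rewrite -[RHS]/(-1 * _) mulN1r.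
have sc : rsmooth (cst (-1 : R) : 'rV[R]_d -> R) by exact: rsmooth_cst.
split; [by move=> i x; rewrite -[LHS]/(-1 * _) pG|exact: rsmoothM|move=> i].
rewrite pdM; [|by move=> x; exact: rsmooth_derivable..].
apply: real_udD; first by apply: real_udM => //; exact: real_ud_cst.
rewrite pd_cst (_ : G * cst 0 = cst 0); first exact: real_ud_cst.
by apply/funext => x; rewrite -[LHS]/(_ * 0) mulr0.
Qed.

Section Shear.
Variables (k : 'I_d) (G : 'rV[R]_d -> R).
Hypothesis Gk : forall z r, G (z + r *: delta_mx ord0 k) = G z.
Hypothesis uG : real_ud_grad G.

Lemma real_ud_partials_bound : exists B hb : R, [/\ 0 <= B, 0 < hb &
  forall i, dbound (pd i G) (fun n => B * ud_weight m hb n)].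
Proof.
have [_ _ uGi] := uG.
have /choice[p Hp] : forall i, exists p : R * R, [/\ 0 < p.1, 0 < p.2 &
    dbound (pd i G) (fun n => p.1 * ud_weight m p.2 n)].
  by move=> i; have [_ _ [C [h H]]] := uGi i; exists (C, h).
have p1 i : 0 <= (p i).1 by case: (Hp i) => /ltW.
have p2 i : 0 <= (p i).2 by case: (Hp i) => _ /ltW.
(* The sums dominate each of the finitely many constants and radii. *)
exists (\sum_i (p i).1), (1 + \sum_i (p i).2).
split; [exact: sumr_ge0|by rewrite ltr_wpDr// sumr_ge0|move=> i].
have [_ h0 b] := Hp i; apply: dbound_ud_weight_le b => //.
  by rewrite (bigD1 i)//= lerDl sumr_ge0.
by rewrite (bigD1 i)//= addrCA lerDl addr_ge0// sumr_ge0.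
Qed.

(** For a given [G] the new radius depends on the old one alone and the constant
  is unchanged: this uniformity is what continuity on each step of the inductive
  limit requires. *)
Lemma real_ud_shear_bound : exists2 K : R -> R, forall h : R, 0 < h -> h <= K h &
  forall g C h, 0 < h -> 0 <= C -> rsmooth g ->
  dbound g (fun n => C * ud_weight m h n) ->
  dbound (g \o shear k G) (fun n => C * ud_weight m (K h) n).
Proof.
have [B [hb [B0 hb0 bG]]] := real_ud_partials_bound; have [_ sG _] := uG.
exists (fun h => (1 + 2 * B) * Num.max h (2 * hb)) => [h h0|g C h h0 C0 sg bg].
  have : h <= Num.max h (2 * hb) by rewrite le_max lexx.
  by move=> hh; rewrite (le_trans hh)// ler_peMl ?(le_trans (ltW h0) hh)// lerDl mulr_ge0.
have hh : h <= Num.max h (2 * hb) by rewrite le_max lexx.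
apply: (dbound_shear hm Gk sG B0 hb0 bG) => //.
  by rewrite ler_pdivlMr// mulrC le_max lexx orbT.
exact: dbound_ud_weight_le bg.
Qed.

Lemma real_periodic_shear (T : Type) (g : 'rV[R]_d -> T) :
  (forall i x, g (x + (2 * pi) *: delta_mx ord0 i) = g x) ->
  forall i x, (g \o shear k G) (x + (2 * pi) *: delta_mx ord0 i) = (g \o shear k G) x.
Proof.
have [pG _ _] := uG.
by move=> pg i x; rewrite /= /shear pG addrAC pg.
Qed.

Lemma real_ud_shear g : real_ud g -> real_ud (g \o shear k G).
Proof.
have [pG sG _] := uG; have [K hK HK] := real_ud_shear_bound.
move=> [pg sg [C [h [C0 h0 b]]]]; split; [exact: real_periodic_shear|exact: rsmooth_shear|].
exists C, (K h); split=> //; first exact: lt_le_trans (hK _ h0).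
by apply: HK => //; exact: ltW.
Qed.

End Shear.
End RealUd.

(** * Complex functions and the dual space *)

Section Modulus.
Variable R : realType.
Implicit Types z : R[i].

Lemma Re_le_normc z : `|complex.Re z| <= normc z.
Proof.
by case: z => x y; rewrite /= -sqrtr_sqr ler_wsqrtr// lerDl sqr_ge0.
Qed.

Lemma Im_le_normc z : `|complex.Im z| <= normc z.
Proof.
by case: z => x y; rewrite /= -sqrtr_sqr ler_wsqrtr// lerDr sqr_ge0.
Qed.

Lemma normc_le_ReIm z : normc z <= `|complex.Re z| + `|complex.Im z|.
Proof.
case: z => x y /=; rewrite -[leRHS]ger0_norm ?addr_ge0// -sqrtr_sqr ler_wsqrtr//.
rewrite sqrrD !real_normK ?num_real// lerD2r lerDl.
by rewrite mulrn_wge0// mulr_ge0.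
Qed.

Lemma normcX z n : normc (z ^+ n) = normc z ^+ n.
Proof. by elim: n => [|n IHn]; rewrite ?expr0 ?normc1// !exprS normcM IHn. Qed.

Lemma normc_Ni : normc (0 -i* 1 : R[i]) = 1.
Proof. by rewrite /= expr0n sqrrN expr1n add0r sqrtr1. Qed.

End Modulus.

Section Complex.
Variables (R : realType) (d : nat).
Local Notation fct := ('rV[R]_d -> R[i]).
Implicit Types (f g : fct) (i j k : 'I_d) (s : seq 'I_d)
  (alpha : {ffun 'I_d -> nat}).

Definition re f : 'rV[R]_d -> R := fun x => complex.Re (f x).
Definition im f : 'rV[R]_d -> R := fun x => complex.Im (f x).

Lemma re_cpartial i f : re (cpartial i f) = pd i (re f).
Proof. by []. Qed.

Lemma im_cpartial i f : im (cpartial i f) = pd i (im f).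
Proof. by []. Qed.

Lemma re_cpartial_seq s f : re (cpartial_seq s f) = pds s (re f).
Proof. by elim: s => //= i s <-. Qed.

Lemma im_cpartial_seq s f : im (cpartial_seq s f) = pds s (im f).
Proof. by elim: s => //= i s <-. Qed.

Lemma fct_ReIm f g : re f = re g -> im f = im g -> f = g.
Proof.
move=> rfg ifg; apply/funext => x.
have := congr1 (fun h => h x) rfg; have := congr1 (fun h => h x) ifg.
by rewrite /re /im; case: (f x) (g x) => a b [a' b'] /= -> ->.
Qed.

Lemma smoothP f : smooth f <-> rsmooth (re f) /\ rsmooth (im f).
Proof.
split=> [sf|[sr si] s].
  split=> s; have [[cr ci] D] := sf s.
    rewrite -re_cpartial_seq; split=> // i x; exact: (D i x).1.
  rewrite -im_cpartial_seq; split=> // i x; exact: (D i x).2.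
have [cr dr] := sr s; have [ci di] := si s.
rewrite -re_cpartial_seq in cr dr; rewrite -im_cpartial_seq in ci di.
split; [by split|move=> i x; split; [exact: dr|exact: di]].
Qed.

Lemma periodicP f : Defs.periodic f <-> real_periodic (re f) /\ real_periodic (im f).
Proof.
split=> [pf|[pr pi] i x].
  by split=> i x; rewrite /re /im pf.
have := pr i x; have := pi i x; rewrite /re /im.
by case: (f _) (f x) => a b [a' b'] /= -> ->.
Qed.

(** The word which [Dmulti] spells out: a multi-index is a sorted word. *)
Definition sorted_word alpha : seq 'I_d :=
  flatten [seq nseq (alpha i) i | i <- enum 'I_d].

Lemma size_mword alpha : size (sorted_word alpha) = mlength alpha.
Proof.
rewrite size_flatten /shape -map_comp sumnE big_map big_enum /=.
by apply: eq_bigr => i _; rewrite /= size_nseq.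
Qed.

Lemma DmultiE alpha f x : Dmulti alpha f x =
  (0 -i* 1) ^+ mlength alpha * cpartial_seq (sorted_word alpha) f x.
Proof.
rewrite /Dmulti /sorted_word; congr (_ * _ x).
elim: (enum 'I_d) => //= i s ->; rewrite /cpartial_seq foldr_cat.
by elim: (alpha i) => //= n ->.
Qed.

Lemma sorted_word_perm s : exists alpha, perm_eq s (sorted_word alpha).
Proof.
exists [ffun i => count_mem i s]; apply/allP => j _ /=; apply/eqP.
rewrite count_flatten -map_comp sumnE big_map big_enum /=.
rewrite (bigD1 j)//= count_nseq ffunE /= eqxx mul1n big1 ?addn0// => i ij.
by rewrite count_nseq /= (negbTE ij) mul0n.
Qed.

Lemma normc_Dmulti alpha f x :
  normc (Dmulti alpha f x) = normc (cpartial_seq (sorted_word alpha) f x).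
Proof. by rewrite DmultiE normcM normcX normc_Ni expr1n mul1r. Qed.

(** A multi-index only controls the words which are sorted; commutation of the
  partial derivatives gives all the others. *)
Lemma Dmulti_dbound f c : smooth f ->
  (forall x alpha, normc (Dmulti alpha f x) <= c (mlength alpha)) ->
  dbound (re f) c /\ dbound (im f) c.
Proof.
move=> /smoothP[sr si] H; split=> s x; have [alpha sa] := sorted_word_perm s;
  rewrite (perm_size sa) size_mword (le_trans _ (H x alpha))// normc_Dmulti.
- by rewrite (pds_perm sr sa) -re_cpartial_seq Re_le_normc.
- by rewrite (pds_perm si sa) -im_cpartial_seq Im_le_normc.
Qed.

(* The factor [2] is the price of working with real and imaginary parts. *)
Lemma dbound_Dmulti f c : dbound (re f) c -> dbound (im f) c ->
  forall x alpha, normc (Dmulti alpha f x) <= 2 * c (mlength alpha).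
Proof.
move=> br bi x alpha; rewrite normc_Dmulti (le_trans (normc_le_ReIm _))//.
rewrite mulrDl !mul1r -size_mword lerD//.
- by rewrite -/(re _ x) re_cpartial_seq.
- by rewrite -/(im _ x) im_cpartial_seq.
Qed.

Variable m : nat -> R.
Hypothesis hm : weight_sequence m.

Lemma udP f : ud m f <-> real_ud m (re f) /\ real_ud m (im f).
Proof.
split=> [[/periodicP[pr pi] sf [C [h [C0 h0 H]]]]|].
  have [sr si] := (smoothP f).1 sf.
  have [br bi] := Dmulti_dbound (c := fun n => C * ud_weight m h n) sf H.
  by split; split=> //; exists C, h.
move=> [[pr sr [C1 [h1 [C10 h10 b1]]]] [pi si [C2 [h2 [C20 h20 b2]]]]].
split; [exact/periodicP|exact/smoothP|].
pose h := Num.max h1 h2; pose C := Num.max C1 C2; exists (2 * C), h.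
have h1h : h1 <= h by rewrite le_max lexx.
have h2h : h2 <= h by rewrite le_max lexx orbT.
have C1C : C1 <= C by rewrite le_max lexx.
have C2C : C2 <= C by rewrite le_max lexx orbT.
split; [by rewrite mulr_gt0// (lt_le_trans C10)|exact: lt_le_trans h1h|].
move=> x alpha; rewrite -mulrA.
apply: (dbound_Dmulti (c := fun n => C * ud_weight m h n)).
- exact: (dbound_ud_weight_le hm (ltW C10) C1C h10 h1h b1).
- exact: (dbound_ud_weight_le hm (ltW C20) C2C h20 h2h b2).
Qed.

Lemma ud_lin (a b : R[i]) f g : ud m f -> ud m g ->
  ud m (fun x => a * f x + b * g x).
Proof.
move=> /udP[rf jf] /udP[rg jg]; apply/udP.
have sc (c : R) F : real_ud m F -> real_ud m (cst c * F).
  by move=> uF; apply: real_udM => //; exact: real_ud_cst.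
split.
- rewrite (_ : re _ = (cst (complex.Re a) * re f + cst (- complex.Im a) * im f) +
    (cst (complex.Re b) * re g + cst (- complex.Im b) * im g)).
    by apply: real_udD => //; apply: real_udD => //; exact: sc.
  apply/funext => x; rewrite /re /im -[RHS]/((_ * _ + _ * _) + (_ * _ + _ * _)) /cst /=.
  by case: a b (f x) (g x) => ? ? [? ?] [? ?] [? ?] /=; rewrite !mulNr.
- rewrite (_ : im _ = (cst (complex.Re a) * im f + cst (complex.Im a) * re f) +
    (cst (complex.Re b) * im g + cst (complex.Im b) * re g)).
    by apply: real_udD => //; apply: real_udD => //; exact: sc.
  apply/funext => x; rewrite /re /im -[RHS]/((_ * _ + _ * _) + (_ * _ + _ * _)) /cst /=.
  case: a b (f x) (g x) => ? ? [? ?] [? ?] [? ?] /=; ring.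
Qed.

Lemma ud_cpartial i f : ud m f -> ud m (cpartial i f).
Proof.
by move=> /udP[rf jf]; apply/udP; rewrite re_cpartial im_cpartial; split; exact: real_ud_pd.
Qed.

Lemma re_rmul (b : 'rV[R]_d -> R) f : re (fun x => (b x)%:C * f x) = b * re f.
Proof.
by apply/funext => x; rewrite /re -[RHS]/(_ * _); case: (f x) => ? ? /=; rewrite mul0r subr0.
Qed.

Lemma im_rmul (b : 'rV[R]_d -> R) f : im (fun x => (b x)%:C * f x) = b * im f.
Proof.
by apply/funext => x; rewrite /im -[RHS]/(_ * _); case: (f x) => ? ? /=; rewrite mul0r addr0.
Qed.

Lemma ud_rmul (b : 'rV[R]_d -> R) f : real_ud m b -> ud m f ->
  ud m (fun x => (b x)%:C * f x).
Proof.
by move=> ub /udP[rf jf]; apply/udP; rewrite re_rmul im_rmul; split; exact: real_udM.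
Qed.

Lemma ud_norm_lt (h r : R) f : 0 < h -> (ud_norm m h f < r%:E)%E ->
  forall x alpha, normc (Dmulti alpha f x) <= r * ud_weight m h (mlength alpha).
Proof.
move=> h0 H x alpha; rewrite -ler_pdivrMr ?ud_weight_gt0// -lee_fin.
apply: le_trans (ltW H); apply: ereal_sup_ubound.
by exists x => //; exists alpha.
Qed.

Lemma ud_norm_le (h r : R) f : 0 < h ->
  (forall x alpha, normc (Dmulti alpha f x) <= r * ud_weight m h (mlength alpha)) ->
  (ud_norm m h f <= r%:E)%E.
Proof.
move=> h0 H; apply: ge_ereal_sup => _ [x _ [alpha _ <-]].
by rewrite lee_fin ler_pdivrMr ?ud_weight_gt0.
Qed.

Section Shear.
Variables (k : 'I_d) (G : 'rV[R]_d -> R).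
Hypothesis Gk : forall z r, G (z + r *: delta_mx ord0 k) = G z.
Hypothesis uG : real_ud_grad m G.

Lemma ud_shear f : ud m f -> ud m (f \o shear k G).
Proof.
by move=> /udP[rf jf]; apply/udP; split; [exact: (real_ud_shear hm Gk uG rf)|
  exact: (real_ud_shear hm Gk uG jf)].
Qed.

Lemma cpartial_shear i f : ud m f -> cpartial i (f \o shear k G) =
  (fun x => 1 * cpartial i f x + (pd i G x)%:C * cpartial k f x) \o shear k G.
Proof.
have [_ sG _] := uG.
move=> /udP[[_ /rsmoothP sr _] [_ /rsmoothP si _]].
have E1 : pd i (re f \o shear k G) = _ := pd_shear Gk sG i (sr 1%N).
have E2 : pd i (im f \o shear k G) = _ := pd_shear Gk sG i (si 1%N).
have aff (c : R) (z w : R[i]) :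
    (complex.Re (1 * z + c%:C * w) = complex.Re z + c * complex.Re w) *
    (complex.Im (1 * z + c%:C * w) = complex.Im z + c * complex.Im w).
  by case: z w => ? ? [? ?] /=; rewrite !mul1r !mul0r !subr0 !addr0.
apply/fct_ReIm; rewrite ?re_cpartial ?im_cpartial.
  by rewrite [LHS]E1; apply/funext => x; rewrite [RHS]aff.
by rewrite [LHS]E2; apply/funext => x; rewrite [RHS]aff.
Qed.

(** The preimage of a basic neighbourhood of [0] is one: the step of radius
  [n.+1] is mapped into a step of radius [p.+1] by a bounded operator. *)
Lemma ud_basic_nbhs0_shear V : ud_basic_nbhs0 m V ->
  ud_basic_nbhs0 m [set f | ud m f /\ V (f \o shear k G)].
Proof.
move=> [Vud Vconv Vstep]; split.
- by move=> f [].
- move=> a b f g [uf Vf] [ug Vg] ab; split; first exact: ud_lin.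
  exact: (Vconv a b (f \o shear k G) (g \o shear k G)).
- move=> n; have [K hK HK] := real_ud_shear_bound hm Gk uG.
  have n0 : (0 : R) < n.+1%:R by rewrite ltr0n.
  have [p Kp] : exists p : nat, K n.+1%:R <= p.+1%:R.
    exists (Num.truncn (K n.+1%:R)).
    by apply: ltW; rewrite truncnS_gt.
  have K0 : 0 < K n.+1%:R by apply: lt_le_trans (hK _ n0).
  (* The composition has norm at most [2 * (r / 3)], which is less than [r]. *)
  have [r r0 Hr] := Vstep p; exists (r / 3); first by rewrite divr_gt0.
  move=> f [pf sf _] fr.
  have r3 : 0 <= r / 3 by rewrite divr_ge0// ltW.
  have fD := ud_norm_lt n0 fr.
  have uf : ud m f.
    by split=> //; exists (r / 3), n.+1%:R; split=> //; rewrite divr_gt0.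
  have ufs := ud_shear uf.
  split=> //.
  have [br bi] := Dmulti_dbound (c := fun q => r / 3 * ud_weight m n.+1%:R q) sf fD.
  have [sr si] := (smoothP f).1 sf.
  have B := dbound_Dmulti (f := f \o shear k G)
    (dbound_ud_weight_le hm r3 (lexx _) K0 Kp (HK _ _ _ n0 r3 sr br))
    (dbound_ud_weight_le hm r3 (lexx _) K0 Kp (HK _ _ _ n0 r3 si bi)).
  have NB : (ud_norm m p.+1%:R (f \o shear k G) < r%:E)%E.
    apply: (@le_lt_trans _ _ (2 * (r / 3))%:E); last by rewrite lte_fin; lra.
    apply: ud_norm_le; first by rewrite ltr0n.
    by move=> x alpha; rewrite -mulrA; exact: B.
  apply: Hr => //; case: ufs => ? ? _; split=> //.
  exact: lt_trans NB (ltry _).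
Qed.

Lemma ud_dual_shear u : ud_dual m u -> ud_dual m (fun f => u (f \o shear k G)).
Proof.
move=> [lu cu]; split=> [a f g uf ug|f uf eps eps0].
  exact: (lu a (f \o shear k G) (g \o shear k G) (ud_shear uf) (ud_shear ug)).
have [V VB VU] := cu _ (ud_shear uf) _ eps0.
exists [set f | ud m f /\ V (f \o shear k G)]; first exact: ud_basic_nbhs0_shear.
by move=> g [_ Vg]; exact: (VU (g \o shear k G)).
Qed.

End Shear.
End Complex.

(** * Integration over the torus *)

Section OneVariable.
Variable R : realType.
Implicit Types (g F : R -> R).
Notation mu := (@lebesgue_measure R).

Lemma continuous_integrable g (a b : R) : continuous g ->
  mu.-integrable `[a, b] (EFin \o g).
Proof.
move=> cg; apply: continuous_compact_integrable; first exact: segment_compact.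
exact: continuous_subspaceT.
Qed.

Lemma Rintegral_subitv g (a b c : R) : continuous g -> a <= b -> b <= c ->
  \int[mu]_(s in `[a, c]) g s =
  \int[mu]_(s in `[a, b]) g s + \int[mu]_(s in `]b, c]) g s.
Proof.
move=> cg ab bc; rewrite -(@Rintegral_itvB _ _ (BLeft a) (BRight c) b) ?bnd_simp//.
  by rewrite addrC subrK.
exact: continuous_integrable.
Qed.

(** An integral from a base point is differentiated to the right of that point.
  Near any given point the primitive based at [0] differs by a constant from one
  based far to the left, which is therefore differentiable there. *)
Lemma continuous_antiderivative g : continuous g ->
  exists F, forall x : R, is_derive x (1 : R) F (g x).
Proof.
move=> cg.
pose F (x : R) : R := if 0 <= x then \int[mu]_(s in `]0, x]) g s
            else - \int[mu]_(s in `]x, 0]) g s.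
have FE (n x : R) : n <= 0 -> n <= x ->
    F x = \int[mu]_(s in `[n, x]) g s - \int[mu]_(s in `[n, 0]) g s.
  move=> n0 nx; rewrite /F; have [x0|x0] := leP 0 x.
    by rewrite (Rintegral_subitv cg n0 x0) addrAC subrr add0r.
  by rewrite (Rintegral_subitv cg nx (ltW x0)) opprD addrA subrr add0r.
exists F => x.
pose n : R := - `|x| - 1.
have n0 : n <= 0 by rewrite /n; have := normr_ge0 x; lra.
have nx : n < x by rewrite /n; have := ler_norm (- x); rewrite normrN; lra.
pose P (y : R) : R := \int[mu]_(s in `[n, y]) g s.
have x1 : x < x + 1 by rewrite ltrDl.
have [dP dPE] : derivable P x 1 /\ P^`()%classic x = g x.
  by apply: (continuous_FTC1_closed x1 (continuous_integrable n (x + 1) cg)) => //; exact: cg.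
have dP1 : is_derive x (1 : R) P (g x) by apply: DeriveDef => //; rewrite -derive1E.
pose c : R := \int[mu]_(s in `[n, 0]) g s.
have dP' : is_derive x (1 : R) (P - cst c) (g x - 0) by apply: is_deriveB.
rewrite subr0 in dP'.
apply: near_eq_is_derive dP'.
have : \forall y \near x, n < y by exact: lt_nbhsr.
by apply: filterS => y ny; rewrite (FE n)// ltW.
Qed.

Lemma is_derive_continuous F g : (forall x : R, is_derive x (1 : R) F (g x)) ->
  continuous F.
Proof.
move=> dF x; apply: differentiable_continuous; apply/derivable1_diffP.
by case: (dF x).
Qed.

Lemma Rintegral_derive F g (a b : R) : continuous g ->
  (forall x : R, is_derive x (1 : R) F (g x)) -> a < b ->
  \int[mu]_(s in `[a, b]) g s = F b - F a.
Proof.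
move=> cg dF ab; have cF := is_derive_continuous dF.
rewrite /Rintegral (@continuous_FTC2 _ g F)//.
- exact: continuous_subspaceT.
- split.
  + by move=> x _; case: (dF x).
  + by apply: cvg_at_right_filter; exact: cF.
  + by apply: cvg_at_left_filter; exact: cF.
- by move=> x _; rewrite derive1E; case: (dF x).
Qed.

Lemma is_derive_translate F g (r : R) : (forall x : R, is_derive x (1 : R) F (g x)) ->
  forall x : R, is_derive x (1 : R) (fun y => F (y + r)) (g (x + r)).
Proof.
move=> dF x; rewrite -[g _]mulr1 -[X in _ * X](addr0 1).
exact: (@is_derive1_comp _ F (fun y => y + r)).
Qed.

Lemma periodic_antiderivative F g (p : R) :
  (forall x : R, is_derive x (1 : R) F (g x)) ->
  (forall x, g (x + p) = g x) -> forall x, F (x + p) - F x = F p - F 0.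
Proof.
move=> dF pg x; rewrite -{2}(add0r p).
apply: (@is_derive_0_is_cst _ (fun y => F (y + p) - F y) x 0) => y.
by rewrite -(subrr (g y)) -{1}(pg y); apply: is_deriveB; exact: is_derive_translate.
Qed.

(** In terms of a primitive [F] of [g] both sides are increments of [F] over one
  period, and these do not depend on the starting point. *)
Lemma Rintegral_translate g (p r : R) : 0 < p -> continuous g ->
  (forall x, g (x + p) = g x) ->
  \int[mu]_(s in `[0, p]) g (s + r) = \int[mu]_(s in `[0, p]) g s.
Proof.
move=> p0 cg pg; have [F dF] := continuous_antiderivative cg.
rewrite (Rintegral_derive _ (is_derive_translate r dF))//; last first.
  move=> x; apply: continuous_comp; last exact: cg.
  by apply: (@continuousD _ _ _ id (cst r)) => //; exact: cst_continuous.
by rewrite (Rintegral_derive cg dF)// add0r (addrC p) (periodic_antiderivative dF pg).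
Qed.

End OneVariable.

Section TorusIntegral.
Variables (R : realType) (N : nat).
Implicit Types (h G : 'rV[R]_N.+1 -> R).
Local Notation k := (x_coord N).

Lemma set_coordE d (i : 'I_d) (s : R) (x : 'rV[R]_d) :
  set_coord i s x = x + (s - x ord0 i) *: delta_mx ord0 i.
Proof.
apply/rowP => j; rewrite !mxE eqxx /=; case: eqVneq => [->|_].
  by rewrite mulr1 addrC subrK.
by rewrite mulr0 addr0.
Qed.

(** The enumeration of the coordinates ends with [x], so the integral in [x] is
  the innermost one, and there the shear is a translation. *)
Lemma torus_integral_real_shear h G :
  (forall z r, G (z + r *: delta_mx ord0 k) = G z) -> continuous h -> real_periodic h ->
  torus_integral_real (h \o shear k G) = torus_integral_real h.
Proof.
move=> Gk ch ph; rewrite /torus_integral_real enum_ordSr !foldr_rcons.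
congr (foldr _ _ _ _); apply/funext => x; rewrite /integral_coord.
pose g (s : R) := h (set_coord k s x).
have gE s : h (shear k G (set_coord k s x)) = g (s + G x).
  by rewrite /g /shear !set_coordE Gk -addrA -scalerDl addrAC.
under eq_Rintegral do rewrite /= gE.
apply: Rintegral_translate.
- by rewrite mulr_gt0// pi_gt0.
- move=> s; rewrite /g.
  rewrite (_ : (fun _ => _) = h \o (fun s => x + (s - x ord0 k) *: delta_mx ord0 k)); last first.
    by apply/funext => t; rewrite /= set_coordE.
  apply: continuous_comp; last exact: ch.
  apply: (@continuousD _ _ _ (cst x) (fun s : R => (s - x ord0 k) *: delta_mx ord0 k)).
    exact: cst_continuous.
  apply: continuousZr_tmp.
  by apply: (@continuousB _ _ _ id (cst (x ord0 k))) => //; exact: cst_continuous.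
- by move=> s; rewrite /g !set_coordE addrAC scalerDl addrA ph.
Qed.

Variable m : nat -> R.
Hypothesis hm : weight_sequence m.
Variable G : 'rV[R]_N.+1 -> R.
Hypothesis Gk : forall z r, G (z + r *: delta_mx ord0 k) = G z.

Lemma shearK : cancel (shear k G) (shear k (- G)).
Proof.
move=> z; rewrite /shear -[(- G) _]/(- G _) Gk scaleNr addrK //.
Qed.

(** The transpose of a shear agrees with the inverse shear on functions. *)
Lemma ud_embed_shear f phi : real_ud_grad m G -> ud m f -> ud m phi ->
  ud_embed f (phi \o shear k G) = ud_embed (f \o shear k (- G)) phi.
Proof.
move=> uG uf uphi; have uNG := real_ud_gradN hm uG.
have NGk z r : (- G) (z + r *: delta_mx ord0 k) = (- G) z.
  by rewrite -[LHS]/(- G _) Gk.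
have /(udP hm)[rf jf] := ud_shear hm NGk uNG uf.
have /(udP hm)[rp jp] := uphi.
rewrite /ud_embed.
set F := f \o shear k (- G).
have E : (fun x => f x * (phi \o shear k G) x) = (fun x => F x * phi x) \o shear k G.
  by apply/funext => x; rewrite /F /= shearK.
have reM : re (fun x => F x * phi x) = re F * re phi + cst (-1) * (im F * im phi).
  apply/funext => x; rewrite /re /im -[RHS]/(_ * _ + -1 * (_ * _)).
  by case: (F x) (phi x) => ? ? [? ?] /=; rewrite mulN1r.
have imM : im (fun x => F x * phi x) = re F * im phi + im F * re phi.
  apply/funext => x; rewrite /re /im -[RHS]/(_ * _ + _ * _).
  case: (F x) (phi x) => ? ? [? ?] /=; ring.
have [pr sr _] : real_ud m (re (fun x => F x * phi x)).
  rewrite reM; apply: (real_udD hm); first exact: (real_udM hm).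
  by apply: (real_udM hm); [exact: real_ud_cst|exact: (real_udM hm)].
have [pi si _] : real_ud m (im (fun x => F x * phi x)).
  by rewrite imM; apply: (real_udD hm); exact: (real_udM hm).
rewrite E /torus_integral; congr (_ +i* _).
- exact: (torus_integral_real_shear Gk (rsmooth_continuous sr) pr).
- exact: (torus_integral_real_shear Gk (rsmooth_continuous si) pi).
Qed.

End TorusIntegral.

(** * Functions of one coordinate and the two systems *)

Section Coordinates.
Variable R : realType.
Implicit Types (a : R -> R).

Definition of_coord d (i : 'I_d) a : 'rV[R]_d -> R := fun z => a (z ord0 i).

Lemma of_coord_quotient d (i j : 'I_d) a (z : 'rV[R]_d) :
  (fun h : R => h^-1 *: (of_coord i a (h *: delta_mx ord0 j + z) - of_coord i a z)) =
  if j == i then fun h : R => h^-1 *: (a (h *: (1 : R) + z ord0 i) - a (z ord0 i))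
  else cst 0.
Proof.
apply/funext => h; rewrite /of_coord !mxE eqxx /= eq_sym.
case: eqVneq => _; first by [].
by rewrite mulr0 add0r subrr scaler0.
Qed.

Lemma pd_of_coord d (i j : 'I_d) a :
  pd j (of_coord i a) = if j == i then of_coord i a^`()%classic else cst 0.
Proof.
apply/funext => z; rewrite /pd /derive of_coord_quotient.
case: eqVneq => _; first by rewrite /of_coord derive1E.
by apply: cvg_lim => //; exact: cvg_cst.
Qed.

Lemma derivable_of_coord d (i j : 'I_d) a (z : 'rV[R]_d) :
  (forall x, derivable a x 1) -> derivable (of_coord i a) z (delta_mx ord0 j).
Proof.
move=> da; rewrite /derivable of_coord_quotient; case: eqVneq => _; first exact: da.
exact: is_cvg_cst.
Qed.

Lemma continuous_of_coord d (i : 'I_d) a : continuous a -> continuous (of_coord i a).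
Proof.
move=> ca z; apply: (@continuous_comp _ _ _ (fun z : 'rV[R]_d => z ord0 i) a).
  exact: coord_continuous.
exact: ca.
Qed.

Lemma pds_of_coord d (i : 'I_d) a s : pds s (of_coord i a) =
  if all (pred1 i) s then of_coord i (derive1n (size s) a) else cst 0.
Proof.
elim: s => //= j s ->; case: (all _ s); last by rewrite andbF pd_cst.
by rewrite andbT pd_of_coord.
Qed.

Variable m : nat -> R.
Hypothesis hm : weight_sequence m.

Local Notation on_circle a := (of_coord (ord0 : 'I_1) a).

(** A function of one variable is recovered on the line from its lift to the
  one-dimensional torus, and lifted again to any torus. *)
Lemma real_ud_of_coord d (i : 'I_d) a : real_ud m (on_circle a) -> real_ud m (of_coord i a).
Proof.
move=> [pa sa [C [h [C0 h0 b]]]].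
have E n : pds (nseq n ord0) (on_circle a) = on_circle (derive1n n a).
  by rewrite pds_of_coord size_nseq all_nseq /= eqxx orbT.
have lift_cst (r : R) (f : R -> R) : on_circle f (const_mx r) = f r.
  by rewrite /of_coord mxE.
have ca n : continuous (derive1n n a).
  have [+ _] := sa (nseq n ord0); rewrite E => cEn.
  rewrite (_ : derive1n n a = on_circle (derive1n n a) \o (fun r => r *: const_mx 1)).
    move=> r; apply: continuous_comp; last exact: cEn.
    by apply: continuousZr_tmp => A.
  by apply/funext => r; rewrite /of_coord /= !mxE mulr1.
have da n (r : R) : derivable (derive1n n a) r 1.
  have [_ /(_ ord0 (const_mx r))] := sa (nseq n ord0); rewrite E.
  by rewrite /derivable of_coord_quotient /= mxE.
have ba n (r : R) : `|derive1n n a r| <= C * ud_weight m h n.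
  by have := b (nseq n ord0) (const_mx r); rewrite E lift_cst size_nseq.
split.
- move=> j z; rewrite /of_coord !mxE eqxx /=; case: eqVneq => _; last by rewrite mulr0 addr0.
  have := pa ord0 (const_mx (z ord0 i)); rewrite /of_coord !mxE eqxx /=.
  by rewrite mulr1.
- move=> s; rewrite pds_of_coord; case: ifP => _; split.
  + exact: continuous_of_coord.
  + by move=> j z; exact: derivable_of_coord.
  + by move=> z; exact: cst_continuous.
  + by move=> j z; exact: derivable_cst.
- exists C, h; split=> // s z; rewrite pds_of_coord; case: ifP => _; first exact: ba.
  rewrite normr0 mulr_ge0 ?(ltW C0)//; apply: ltW; exact: ud_weight_gt0.
Qed.

Lemma on_circle_continuous a : real_ud m (on_circle a) -> continuous a.
Proof.
move=> [_ sa _]; rewrite (_ : a = on_circle a \o (fun r => r *: const_mx 1)).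
  move=> r; apply: continuous_comp; last exact: (rsmooth_continuous sa).
  by apply: continuousZr_tmp => A.
by apply/funext => r; rewrite /of_coord /= !mxE mulr1.
Qed.

Lemma on_circle_periodic a : real_ud m (on_circle a) -> forall x, a (x + 2 * pi) = a x.
Proof.
move=> [pa _ _] x; have := pa ord0 (const_mx x).
by rewrite /of_coord !mxE eqxx /= mulr1.
Qed.

(** The derivatives of positive order of the primitive [A] are derivatives of
  [a], so the estimates for [a] carry over. *)
Lemma real_ud_grad_of_coord d (i : 'I_d) A a : real_ud m (on_circle a) ->
  (forall x : R, is_derive x (1 : R) A (a x)) ->
  (forall x, A (x + 2 * pi) = A x) ->
  real_ud_grad m (of_coord i A) /\ pd i (of_coord i A) = of_coord i a.
Proof.
move=> ua dA pA.
have A1 : A^`()%classic = a.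
  by apply/funext => x; rewrite derive1E; case: (dA x).
have dA1 x : derivable A x 1 by case: (dA x).
have rpd j : real_ud m (pd j (of_coord i A)).
  by rewrite pd_of_coord A1; case: eqVneq => _; [exact: real_ud_of_coord|exact: real_ud_cst].
split; last by rewrite pd_of_coord eqxx A1.
split=> //.
- move=> j z; rewrite /of_coord !mxE eqxx /=; case: eqVneq => _; last by rewrite mulr0 addr0.
  by rewrite mulr1 pA.
- apply/rsmoothP => -[|n]; first by split=> //; exact/continuous_of_coord/(is_derive_continuous dA).
  split; first exact/continuous_of_coord/(is_derive_continuous dA).
  split=> [j z|j]; first exact: derivable_of_coord.
  by case: (rpd j) => _ /rsmoothP.
Qed.

Lemma real_ud_grad_sum d n (F : 'I_n -> 'rV[R]_d -> R) : (forall j, real_ud_grad m (F j)) ->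
  real_ud_grad m (\sum_j F j) /\ forall i, pd i (\sum_j F j) = \sum_j pd i (F j).
Proof.
move=> uF; elim: (index_enum _) => [|j r [[pG sG uG] dG]].
  rewrite !big_nil; have pd0 i : pd i (0 : 'rV[R]_d -> R) = 0 by exact: pd_cst.
  split=> [|i]; last by rewrite big_nil pd0.
  split=> [//||i]; first exact: rsmooth_cst.
  by rewrite pd0; exact: real_ud_cst.
rewrite !big_cons; have [pF sF uFj] := uF j.
have dD i : pd i (F j + \sum_(l <- r) F l) = pd i (F j) + \sum_(l <- r) pd i (F l).
  by rewrite pdD ?dG// => x; exact: rsmooth_derivable.
split=> [|i]; last by rewrite big_cons dD.
split=> [i z||i]; last by rewrite dD -dG; exact: real_udD.
- by rewrite -[LHS]/(F j _ + (\sum_(l <- r) F l) _) pF pG.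
- exact: rsmoothD.
Qed.

End Coordinates.

Section Transfer.
Variables (R : realType) (m : nat -> R) (N : nat).
Hypothesis hm : weight_sequence m.
Local Notation fct := ('rV[R]_N.+1 -> R[i]).
Local Notation k := (x_coord N).
Local Notation on_circle a := (of_coord (ord0 : 'I_1) a).
Implicit Types (a b c A : 'I_N -> R -> R).

Definition field_system a (j : 'I_N) : (fct -> R[i]) -> fct -> R[i] :=
  vector_field j (fun z : 'rV[R]_N.+1 => (a j (z ord0 (t_coord j)))%:C).

Lemma t_coord_neq_x (j : 'I_N) : (t_coord j == k) = false.
Proof. by apply/eqP => /(congr1 val) /= E; have := ltn_ord j; rewrite E ltnn. Qed.

Lemma x_coord_neq_t (j : 'I_N) : (k == t_coord j) = false.
Proof. by rewrite eq_sym t_coord_neq_x. Qed.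

Lemma of_coord_t_shift (j : 'I_N) (f : R -> R) (z : 'rV[R]_N.+1) r :
  of_coord (t_coord j) f (z + r *: delta_mx ord0 k) = of_coord (t_coord j) f z.
Proof. by rewrite /of_coord !mxE eqxx t_coord_neq_x mulr0 addr0. Qed.

Lemma cpartial_x_rmul (j : 'I_N) (f : R -> R) (phi : fct) :
  real_ud m (of_coord (t_coord j) f) -> ud m phi ->
  cpartial k (fun z => (of_coord (t_coord j) f z)%:C * phi z) =
  (fun z => (of_coord (t_coord j) f z)%:C * cpartial k phi z).
Proof.
move=> [_ sf _] /(udP hm)[[_ sr _] [_ si _]].
have aux (g : 'rV[R]_N.+1 -> R) : rsmooth g ->
    pd k (of_coord (t_coord j) f * g) = of_coord (t_coord j) f * pd k g.
  move=> sg; rewrite pdM; [|by move=> x; exact: rsmooth_derivable..].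
  rewrite pd_of_coord x_coord_neq_t; apply/funext => x.
  by rewrite -[LHS]/(_ * _ + _ * 0) mulr0 addr0.
apply: fct_ReIm.
- by rewrite re_cpartial !re_rmul aux.
- by rewrite im_cpartial !im_rmul aux.
Qed.

(** Let [S] be the shear along [x] by [\sum_j A j (t_j)]. The transpose [v] of
  composition with [S], applied to [u], satisfies the system with coefficients
  [b] with right-hand sides transported from those of [u] for [c]; once [v] is a
  function, so is [u], since the inverse shear recovers it. *)
Lemma globally_hypoelliptic_transfer b c A :
  (forall j, real_ud m (on_circle (b j))) -> (forall j, real_ud m (on_circle (c j))) ->
  (forall j (x : R), is_derive x (1 : R) (A j) (b j x - c j x)) ->
  (forall j x, A j (x + 2 * pi) = A j x) ->
  globally_hypoelliptic m (field_system b) ->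
  globally_hypoelliptic m (field_system c).
Proof.
move=> ub uc dA pA Hb u ud_u Hu.
have ubc j : real_ud m (on_circle (b j - c j)).
  have -> : on_circle (b j - c j) = on_circle (b j) + cst (-1) * on_circle (c j).
    by apply/funext => z; rewrite -[RHS]/(_ + -1 * _) mulN1r.
  by apply: (real_udD hm) => //; apply: (real_udM hm) => //; exact: real_ud_cst.
pose F j : 'rV[R]_N.+1 -> R := of_coord (t_coord j) (A j).
pose G := \sum_j F j.
have uF j : real_ud_grad m (F j) /\ pd (t_coord j) (F j) = of_coord (t_coord j) (b j - c j).
  exact: real_ud_grad_of_coord.
have [uG dG] := real_ud_grad_sum hm (fun j => (uF j).1).
have Gk z r : G (z + r *: delta_mx ord0 k) = G z.
  by rewrite /G !fct_sumE; apply: eq_bigr => j _; exact: of_coord_t_shift.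
have dGt j : pd (t_coord j) G = of_coord (t_coord j) (b j - c j).
  rewrite dG (bigD1 j)//= (uF j).2 big1 ?addr0// => l lj.
  rewrite pd_of_coord ifF//; apply: contra_neqF lj => /eqP/(congr1 val)/= E.
  exact/val_inj/esym.
have dGx : pd k G = cst 0.
  by rewrite dG big1// => l _; rewrite pd_of_coord x_coord_neq_t.
pose v : fct -> R[i] := fun phi => u (phi \o shear k G).
have uv : ud_dual m v by exact: ud_dual_shear.
have NGk z r : (- G) (z + r *: delta_mx ord0 k) = (- G) z.
  by rewrite -[LHS]/(- G _) Gk.
have uNG := real_ud_gradN hm uG.
have [lu _] := ud_u.
have Lv j phi : ud m phi ->
    field_system b j v phi = field_system c j u (phi \o shear k G).
  move=> uphi; have utphi := ud_cpartial hm (t_coord j) uphi.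
  have uxphi := ud_cpartial hm k uphi.
  have cb : real_ud m (of_coord (t_coord j) (b j)) by exact: real_ud_of_coord.
  have cc : real_ud m (of_coord (t_coord j) (c j)) by exact: real_ud_of_coord.
  have cbc : real_ud m (of_coord (t_coord j) (b j - c j)) by exact: real_ud_of_coord.
  have uphiS : ud m (phi \o shear k G) by exact: ud_shear.
  rewrite /field_system /vector_field /dual_mul /dual_partial /v -!opprD; congr (- _).
  rewrite (cpartial_x_rmul cb uphi) (cpartial_x_rmul cc uphiS).
  rewrite !(cpartial_shear hm Gk uG _ uphi) dGt dGx.
  set P := cpartial (t_coord j) phi \o shear k G.
  set Q := cpartial k phi \o shear k G.
  have uP : ud m P by exact: ud_shear.
  have uQ : ud m Q by exact: ud_shear.
  have uadd f g : ud m f -> ud m g -> u f + u g = u (fun z => 1 * f z + g z).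
    by move=> uf ug; rewrite lu// mul1r.
  have cS f z : of_coord (t_coord j) f (shear k G z) = of_coord (t_coord j) f z.
    exact: of_coord_t_shift.
  rewrite (_ : _ \o _ = (fun z => (of_coord (t_coord j) (b j) z)%:C * Q z)); last first.
    by apply/funext => z; rewrite /= cS.
  rewrite (_ : _ \o _ = (fun z => 1 * P z + (of_coord (t_coord j) (b j - c j) z)%:C * Q z));
    last by apply/funext => z; rewrite /= cS.
  have -> : (fun z => (of_coord (t_coord j) (c j) z)%:C *
      ((fun x => 1 * cpartial k phi x + (cst 0 x : R)%:C * cpartial k phi x)
        \o shear k G) z) = (fun z => (of_coord (t_coord j) (c j) z)%:C * Q z).
    by apply/funext => z; rewrite /= mul1r mul0r addr0.
  (* Both sides are [u] at [P + b Q], with [Q] the transported [x]-derivative. *)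
  rewrite !uadd//; try exact: ud_rmul; last first.
    have := ud_lin hm 1 1 uP (ud_rmul hm cbc uQ).
    by under eq_fun do rewrite (mul1r (_%:C * _)).
  congr (u _); apply/funext => z.
  rewrite (_ : of_coord _ (b j - c j) z = of_coord (t_coord j) (b j) z - of_coord (t_coord j) (c j) z)//.
  by rewrite rmorphB; ring.
have [j|g ug Hg] := Hb v uv.
  have [f uf Hf] := Hu j; exists (f \o shear k (- G)); first exact: ud_shear.
  move=> phi uphi; rewrite -(ud_embed_shear hm Gk uG uf uphi) -Hf; first exact: Lv.
  exact: ud_shear.
exists (g \o shear k G); first exact: ud_shear.
move=> phi uphi; have uphiN : ud m (phi \o shear k (- G)) by exact: ud_shear.
have KS : (phi \o shear k (- G)) \o shear k G = phi.
  by apply/funext => z; rewrite /= shearK.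
rewrite -[in LHS]KS -[u _]/(v (phi \o shear k (- G))) Hg//.
by rewrite (ud_embed_shear hm NGk uNG ug uphi) opprK.
Qed.

End Transfer.

Local Close Scope classical_set_scope.

Theorem theorem6p16 (R : realType) (m : nat -> R) (N : nat)
    (a : 'I_N -> R -> R)
    (hm : weight_sequence m)
    (hN : (0 < N)%N)
    (ha : forall j : 'I_N,
      ud m (fun t : 'rV[R]_1 => (a j (t ord0 ord0))%:C)) :
  globally_hypoelliptic m
    (fun j : 'I_N =>
       vector_field j (fun z : 'rV[R]_N.+1 => (a j (z ord0 (t_coord j)))%:C))
  <->
  globally_hypoelliptic m
    (fun j : 'I_N =>
       vector_field j (fun _ : 'rV[R]_N.+1 => (mean (a j))%:C)).
Proof.
have ua j : real_ud m (of_coord (ord0 : 'I_1) (a j)) by have /(udP hm)[] := ha j.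
pose c (j : 'I_N) : R -> R := cst (mean (a j)).
have uc j : real_ud m (of_coord (ord0 : 'I_1) (c j)) by exact: real_ud_cst.
have /choice[F dF] : forall j, exists F : R -> R,
    forall x : R, is_derive x (1 : R) F (a j x).
  by move=> j; exact/continuous_antiderivative/(on_circle_continuous (ua j)).
(* Subtracting a linear function from a primitive of [a j] removes its increment
  over one period. *)
pose A (j : 'I_N) : R -> R := F j - mean (a j) *: id.
have dA j x : is_derive x (1 : R) (A j) (a j x - c j x).
  rewrite -[c j x]mulr1; apply: is_deriveB; exact: dF.
have pA j x : A j (x + 2 * pi) = A j x.
  have pi2 : 0 < 2 * pi :> R by rewrite mulr_gt0// pi_gt0.
  apply/eqP; rewrite -subr_eq0; apply/eqP.
  rewrite -[A j _]/(F j _ - mean (a j) * (x + 2 * pi)) -[A j x]/(F j x - mean (a j) * x).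
  have := periodic_antiderivative (dF j) (on_circle_periodic (ua j)) x.
  rewrite -(Rintegral_derive (on_circle_continuous (ua j)) (dF j) pi2) => E.
  rewrite (_ : _ - _ = (F j (x + 2 * pi) - F j x) - mean (a j) * (2 * pi)); last by ring.
  by rewrite E /mean mulrAC mulVf ?mul1r ?subrr// gt_eqF.
split.
- exact: (globally_hypoelliptic_transfer (c := c) hm ua uc dA pA).
- apply: (globally_hypoelliptic_transfer (b := c) (A := fun j => - A j) hm uc ua).
  + by move=> j x; rewrite -opprB; exact: is_deriveN.
  + by move=> j x; rewrite -[LHS]/(- A j _) pA.
Qed.
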